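(* There is an algorithm that, given a matrix $A\in\mathbb{C}^{n\times n}$, an approximate eigenpair $(\zeta,w)$ of $A$ returned on input $A$ by any of the three algorithms Single_Eigenpair, All_Eigenpairs, Random_initial_triple (described in the context), and an accuracy $\varepsilon\in(0,1/2)$, produces an $\varepsilon$-forward approximation (in relative error) of the approximated true eigenpair $(\lambda,v)$ of $A$, i.e. of the eigenpair associated with $(\zeta,w)$. That is, it outputs a pair $(\zeta',w')$ with $$d_{\mathbb P}(w',v)\le\varepsilon\qquad\text{and}\qquad |\zeta'-\lambda|\le\varepsilon|\lambda| .$$ The algorithm terminates provided $\lambda\neq 0$. Its average cost over Gaussian matrices $A$ (entries i.i.d. standard complex Gaussian), independently of the chosen approximate eigenpair, is $O\big(n^3\log_2\log_2(n/\varepsilon)\big)$.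
   Context: Here $n\ge2$, computations are in infinite precision, and cost is the number of arithmetic operations. $\|\cdot\|_F$ is the Frobenius norm, with $\langle A,B\rangle_F=\mathrm{tr}(B^*A)$; $\|\cdot\|$ is the Euclidean norm on vectors and the operator norm on matrices. A standard complex Gaussian has independent real and imaginary parts, each $N(0,\tfrac12)$. For nonzero $v,w\in\mathbb C^n$, $d_{\mathbb P}(v,w)=\arccos\frac{|\langle v,w\rangle|}{\|v\|\|w\|}$. For $A\ne0$, $\mathrm{dist}_A((\lambda,v),(\lambda',v'))^2=\frac{|\lambda-\lambda'|^2}{\|A\|_F^2}+d_{\mathbb P}(v,v')^2$. For $v\neq0$, $P_{v^\perp}$ is the orthogonal projection onto $v^\perp$, $A_{\lambda,v}=P_{v^\perp}(A-\lambda\,\mathrm{Id})|_{v^\perp}:v^\perp\to v^\perp$, and $\mu(A,\lambda,v)=\|A\|_F\|A_{\lambda,v}^{-1}\|$ ($\infty$ if $A_{\lambda,v}$ is not invertible). Newton map. Let $F_A(\lambda,v)=(A-\lambda\,\mathrm{Id})v$, with derivative $DF_A(\lambda,v)(\eta,x)=(A-\lambda\,\mathrm{Id})x-\eta v$. Then $N_A(\lambda,v)=(\lambda-\dot\lambda,v-\dot v)$, where $(\dot\lambda,\dot v)=\big(DF_A(\lambda,v)|_{\mathbb C\times v^\perp}\big)^{-1}F_A(\lambda,v)$; it is defined when $A_{\lambda,v}$ is invertible. $N_A^k$ is the $k$-th iterate. Approximate eigenpair. Let $Av=\lambda v$ with $v\ne 0$ and $A_{\lambda,v}$ invertible. Then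 $(\zeta,w)\in\mathbb C\times(\mathbb C^n\setminus\{0\})$ is an approximate eigenpair of $A$ with associated eigenpair $(\lambda,v)$ if for all $k\ge1$ the iterate $N_A^k(\zeta,w)$ is well defined and $\mathrm{dist}_A(N_A^k(\zeta,w),(\lambda,v))\le(\tfrac12)^{2^k-1}\,\mathrm{dist}_A((\zeta,w),(\lambda,v))$. Step-size routine Choose_step$(B,\dot A,\zeta,w)$, where $\|B\|_F=\|\dot A\|_F=1$ and $\|w\|=1$. Constants: $c_1=\sqrt3\cdot10^{-3}$, $c_u=\sqrt3\cdot10^{-3}+\frac{3c_1^2(\sqrt3-1)}{2(1-3c_1)}$. Compute $r>0$ with $\mu(B,\zeta,w)\le r\le\sqrt3\,\mu(B,\zeta,w)$; put $s'=c_1/r$, $\Phi=\|(DF_B(\zeta,w)|_{\mathbb C\times w^\perp})^{-1}\dot Aw\|$, $\beta=\|(DF_B(\zeta,w)|_{\mathbb C\times w^\perp})^{-1}F_B(\zeta,w)\|$; let $s''$ be the solution of $\frac{\Phi s''+\beta+\frac32c_1^2\sqrt3/r}{1-3c_1}=\frac{c_u}{r}$. Return $\min(s',s'')$. Routine Path-follow$(A,A_0,\zeta_0,w_0)$, with $A,A_0\neq0$ and $\mathbb RA_0\ne\mathbb RA$, $\|w_0\|=1$. Replace $A_0,\zeta_0$ by $A_0/\|A_0\|_F,\ \zeta_0/\|A_0\|_F$ and put $A_1=A/\|A\|_F$. Let $\alpha=\arccos\mathrm{Re}\langle A_0,A_1\rangle_F\in(0,\pi)$ and let $s\mapsto B_s$,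 $0\le s\le\alpha$, be the arc-length parametrized great-circle arc of length $\alpha$ in the unit sphere of $\mathbb C^{n\times n}$ from $A_0$ to $A_1$. Start with $s_0=0$, $i=0$ and repeat: let $\Delta s$ be the output of Choose_step$(B_{s_i},\dot B_{s_i},\zeta_i,w_i)$, with $w_i$ represented by a unit vector; $s_{i+1}=\min\{\alpha,s_i+\Delta s\}$; $(\zeta_{i+1},w_{i+1})=N^3_{B_{s_{i+1}}}(\zeta_i,w_i)$; if $|\zeta_{i+1}|>1$, replace $\zeta_{i+1}$ by $\zeta_{i+1}/|\zeta_{i+1}|$; increase $i$ by 1; until $s_i=\alpha$. Return $(\|A\|_F\zeta_i,w_i)$. The three algorithms, on input $A\in\mathbb C^{n\times n}$ ($e_1,\dots,e_n$ is the standard basis): Single_Eigenpair returns Path-follow$(A,H,1,e_1)$, where $H=\mathrm{diag}(1,0,\dots,0)$. All_Eigenpairs returns the $n$ pairs Path-follow$(A,D,\eta_j,e_j)$, $j=1,\dots,n$, where $D=\mathrm{diag}(\eta_1,\dots,\eta_n)$ and $\eta_1,\eta_2,\dots$ are the points of the unit-side hexagonal lattice $\{a+b(\tfrac12+\tfrac{\sqrt3}2\sqrt{-1}):a,b\in\mathbb Z\}$ in an order such that $0=|\eta_1|\le|\eta_2|\le\cdots$. Random_initial_triple returns Path-follow$(A,A_0,\lambda_0,e_1)$, where $(A_0,\lambda_0)$ is random: draw $\lambda_0\in\mathbb C$, $u\in\mathbb C^{n-1}$, $M\in\mathbb C^{(n-1)\times n}$ independently with i.i.d. standard complex Gaussian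 entries, and $Q$ uniformly from the $n\times(n-1)$ matrices with $Q^*Q=I_{n-1}$ and $\ker Q^*=\ker M$, all conditioned on $2\,\mathrm{Re}(\bar\lambda_0\,\mathrm{tr}(MQ))\le1-|\lambda_0|^2(n-1)$; put $A_0=\begin{pmatrix}\lambda_0&u^*\\0&MQ+\lambda_0I_{n-1}\end{pmatrix}$. For each of the three algorithms, for almost every $A$ the returned pairs are (almost surely) approximate eigenpairs of $A$. *)

(* Defs.v *)
From HB Require Import structures.
From mathcomp Require Import all_boot all_order all_algebra.
From mathcomp Require Import all_classical all_reals all_analysis.
From mathcomp Require Import measurable_realfun complex.
Set Implicit Arguments.
Unset Strict Implicit.
Unset Printing Implicit Defensive.
Import Order.TTheory GRing.Theory Num.Theory.
Import numFieldNormedType.Exports.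

Local Open Scope classical_set_scope.
Local Open Scope ring_scope.
Local Open Scope complex_scope.
Local Open Scope sesquilinear_scope.

Section Geometry.
Variable R : realType.
Local Notation C := R[i].

Definition cabs (z : C) : R := complex.Re `|z|.

(* For column vectors (q = 1) this is the Hermitian product of C^p. *)
Definition dotF p q (A B : 'M[C]_(p, q)) : C := \tr (B^t* *m A).

(* Frobenius norm of a matrix, Euclidean norm of a column vector. *)
Definition normF p q (A : 'M[C]_(p, q)) : R := Num.sqrt (complex.Re (dotF A A)).

Variable n : nat.
Implicit Types (A B : 'M[C]_n) (v w x : 'cV[C]_n) (z : C * 'cV[C]_n).

Definition dP v w : R := acos (cabs (dotF v w) / (normF v * normF w)).

Definition dist_pair A z z' : R :=
  Num.sqrt ((cabs (z.1 - z'.1)) ^+ 2 / (normF A) ^+ 2 + (dP z.2 z'.2) ^+ 2).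

Definition perp v : set 'cV[C]_n := [set x | dotF x v = 0].

Definition proj_perp v x : 'cV[C]_n := x - (dotF x v / dotF v v) *: v.

(* [restr A l v] only matters on [perp v], where it is A_{l,v}. *)
Definition restr A (l : C) v x : 'cV[C]_n := proj_perp v ((A - l%:M) *m x).

Definition restr_inv A l v : 'cV[C]_n -> 'cV[C]_n :=
  'pinv_(fun=> 0) (perp v) (restr A l v).

Definition restr_invertible A l v : Prop :=
  v <> 0 /\ set_bij (perp v) (perp v) (restr A l v).

Definition mu A l v : \bar R :=
  if `[< restr_invertible A l v >] then
    (normF A *
     sup [set normF (restr_inv A l v y) | y in [set y | perp v y /\ normF y <= 1]])%:E
  else +oo%E.

Definition FA A (l : C) v : 'cV[C]_n := (A - l%:M) *m v.

Definition DFA A (l : C) v (z : C * 'cV[C]_n) : 'cV[C]_n :=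
  (A - l%:M) *m z.2 - z.1 *: v.

(* Inverse of the restriction of DF_A(l, v) to C x v^perp. *)
Definition DFA_inv A l v : 'cV[C]_n -> C * 'cV[C]_n :=
  'pinv_(fun=> (0, 0)) [set z | perp v z.2] (DFA A l v).

Definition newton A z : option (C * 'cV[C]_n) :=
  if `[< restr_invertible A z.1 z.2 >] then
    let d := DFA_inv A z.1 z.2 (FA A z.1 z.2) in
    Some (z.1 - d.1, z.2 - d.2)
  else None.

Definition newton_iter A k z : option (C * 'cV[C]_n) :=
  iter k (obind (newton A)) (Some z).

Definition approx_eigenpair A (zeta : C) w (l : C) v : Prop :=
  [/\ A *m v = l *: v, restr_invertible A l v, w <> 0 &
      forall k, (1 <= k)%N -> exists2 z, newton_iter A k (zeta, w) = Some z &
        dist_pair A z (l, v) <=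
          (1 / 2) ^+ (2 ^ k - 1) * dist_pair A (zeta, w) (l, v)].

End Geometry.

Section PathFollow.
Variable R : realType.
Local Notation C := R[i].

Definition c1 : R := Num.sqrt 3 * 10 ^- 3.

Definition cu : R :=
  Num.sqrt 3 * 10 ^- 3
  + 3 * c1 ^+ 2 * (Num.sqrt 3 - 1) / (2 * (1 - 3 * c1)).

Variable n : nat.
Implicit Types (A B : 'M[C]_n) (v w u : 'cV[C]_n).

(* [choose_step B B' zeta u ds] : ds is a possible output of the step-size
   routine, the number r being only determined up to a factor sqrt 3.
   When Phi = 0 the equation for s'' does not constrain the step (s'' = +oo). *)
Definition choose_step B B' (zeta : C) u (ds : R) : Prop :=
  exists r : R,
    [/\ 0 < r, (mu B zeta u <= r%:E)%E,
        (r%:E <= (Num.sqrt 3)%:E * mu B zeta u)%E &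
    let s' := c1 / r in
    let normP (z : C * 'cV[C]_n) := Num.sqrt (cabs z.1 ^+ 2 + normF z.2 ^+ 2) in
    let Phi := normP (DFA_inv B zeta u (B' *m u)) in
    let beta := normP (DFA_inv B zeta u (FA B zeta u)) in
    (Phi = 0 /\ ds = s') \/
    (Phi <> 0 /\ exists2 s'' : R,
       (Phi * s'' + beta + 3 / 2 * c1 ^+ 2 * Num.sqrt 3 / r) / (1 - 3 * c1)
         = cu / r
       & ds = Num.min s' s'')].

Section Arc.
(* Unit matrices, A1 not proportional to A0 over the reals. *)
Variables A0 A1 : 'M[C]_n.

Definition arc_length : R := acos (complex.Re (dotF A0 A1)).

Definition arc_dir : 'M[C]_n :=
  (sin arc_length)^-1%:C *: (A1 - (cos arc_length)%:C *: A0).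

Definition circle_arc (s : R) : 'M[C]_n := (cos s)%:C *: A0 + (sin s)%:C *: arc_dir.

Definition circle_arc_deriv (s : R) : 'M[C]_n :=
  (- sin s)%:C *: A0 + (cos s)%:C *: arc_dir.

Definition clip (z : C) : C := if 1 < cabs z then z / (cabs z)%:C else z.

(* [pf_reach zeta0 w0 s zeta w] : the loop can reach the state (s, zeta, w).
   The vector component stands for a point of projective space: any nonzero
   multiple of the vector produced by Newton's map may be stored. *)
Inductive pf_reach (zeta0 : C) (w0 : 'cV[C]_n) : R -> C -> 'cV[C]_n -> Prop :=
| pf_start : pf_reach zeta0 w0 0 zeta0 w0
| pf_step s zeta w (a : C) ds (z : C * 'cV[C]_n) (b : C) :
    pf_reach zeta0 w0 s zeta w ->
    s <> arc_length ->
    normF (a *: w) = 1 ->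
    choose_step (circle_arc s) (circle_arc_deriv s) zeta (a *: w) ds ->
    let s1 := Num.min arc_length (s + ds) in
    newton_iter (circle_arc s1) 3 (zeta, a *: w) = Some z ->
    b <> 0 ->
    pf_reach zeta0 w0 s1 (clip z.1) (b *: z.2).

End Arc.

Definition path_follow A A0 (zeta0 : C) w0 (zeta : C) w : Prop :=
  [/\ A <> 0, A0 <> 0, (forall t : R, A <> t%:C *: A0), normF w0 = 1 &
   let nA0 := (normF A0)^-1%:C *: A0 in
   let nA1 := (normF A)^-1%:C *: A in
   exists2 zeta1 : C,
     pf_reach nA0 nA1 ((normF A0)^-1%:C * zeta0) w0 (arc_length nA0 nA1) zeta1 w
     & zeta = (normF A)%:C * zeta1].

End PathFollow.

(* Throughout, matrices of order n = m.+1; e_j is [delta_mx j 0]. *)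
Section Algorithms.
Variables (R : realType) (m : nat).
Local Notation C := R[i].
Implicit Types (A : 'M[C]_m.+1) (zeta : C) (w : 'cV[C]_m.+1).

Definition single_eigenpair A zeta w : Prop :=
  path_follow A (delta_mx ord0 ord0) 1 (delta_mx ord0 0) zeta w.

Definition hex_lattice : set C :=
  [set a%:~R + b%:~R * ((1 / 2) +i* (Num.sqrt 3 / 2)) | a in [set: int] & b in [set: int]].

Definition hex_enum (eta : nat -> C) : Prop :=
  set_bij [set: nat] hex_lattice eta /\
  forall j, cabs (eta j) <= cabs (eta j.+1).

Definition all_eigenpairs A zeta w : Prop :=
  exists eta : nat -> C, hex_enum eta /\
  exists j : 'I_m.+1,
    path_follow A (diag_mx (\row_k eta k)) (eta j) (delta_mx j 0) zeta w.

(* The possible draws: the Gaussian data have full support, u is unconstrained,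
   and the conditioning is the last inequality. *)
Definition random_draw (l0 : C) (M : 'M[C]_(m, m.+1))
    (Q : 'M[C]_(m.+1, m)) : Prop :=
  [/\ Q^t* *m Q = 1%:M,
      (forall x : 'cV[C]_m.+1, Q^t* *m x = 0 <-> M *m x = 0) &
      2 * complex.Re (l0^* * \tr (M *m Q)) <= 1 - cabs l0 ^+ 2 * m%:R].

Definition random_initial_triple A zeta w : Prop :=
  exists l0 u M Q, random_draw l0 M Q /\
    path_follow A
      (block_mx (l0%:M : 'M[C]_1) (u^t*) 0 (M *m Q + l0%:M) : 'M[C]_(1 + m))
      l0 (delta_mx ord0 0) zeta w.

Definition returned A zeta w : Prop :=
  [\/ single_eigenpair A zeta w, all_eigenpairs A zeta w
    | random_initial_triple A zeta w].

End Algorithms.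

(* Infinite-precision machine: a finite program, independent of n, over natural
   number registers (for indices) and arrays of complex numbers, with exact
   arithmetic, conjugation and comparison of real parts; each of these is a
   bounded number of real arithmetic operations. The only constants are natural
   numbers. *)
Inductive iexp : Type :=
| IVar of nat
| ICst of nat
| IAdd of iexp & iexp
| ISub of iexp & iexp
| IMul of iexp & iexp.

(* [CMem a e] is the entry of index e of the array a. *)
Inductive cexp : Type :=
| CMem of nat & iexp
| CCst of nat
| CAdd of cexp & cexp
| CSub of cexp & cexp
| CMul of cexp & cexp
| CDiv of cexp & cexp
| CConj of cexp.

Inductive test : Type :=
| TLtI of iexp & iexp
| TLeRe of cexp & cexp
| TNot of test.

Inductive prog : Type :=
| Skip
| ISet of nat & iexp
| CSet of nat & iexp & cexp
| Seq of prog & prog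
| If of test & prog & prog
| While of test & prog.

Section Machine.
Variable R : realType.
Local Notation C := R[i].

Record state := State { ivar : nat -> nat; cmem : nat -> nat -> C }.

Fixpoint ieval (s : state) (e : iexp) : nat :=
  match e with
  | IVar x => ivar s x
  | ICst k => k
  | IAdd e1 e2 => ieval s e1 + ieval s e2
  | ISub e1 e2 => ieval s e1 - ieval s e2
  | IMul e1 e2 => ieval s e1 * ieval s e2
  end%N.

Fixpoint ceval (s : state) (e : cexp) : C :=
  match e with
  | CMem a k => cmem s a (ieval s k)
  | CCst k => k%:R
  | CAdd e1 e2 => ceval s e1 + ceval s e2
  | CSub e1 e2 => ceval s e1 - ceval s e2
  | CMul e1 e2 => ceval s e1 * ceval s e2
  | CDiv e1 e2 => ceval s e1 / ceval s e2
  | CConj e1 => (ceval s e1)^*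
  end.

Fixpoint teval (s : state) (t : test) : bool :=
  match t with
  | TLtI e1 e2 => (ieval s e1 < ieval s e2)%N
  | TLeRe e1 e2 => complex.Re (ceval s e1) <= complex.Re (ceval s e2)
  | TNot t1 => ~~ teval s t1
  end.

End Machine.

(* Every operation, test and assignment is counted, including those on indices,
   so the cost is at least the number of arithmetic operations. *)
Fixpoint icost (e : iexp) : nat :=
  match e with
  | IVar _ | ICst _ => 0
  | IAdd e1 e2 | ISub e1 e2 | IMul e1 e2 => (icost e1 + icost e2).+1
  end%N.

Fixpoint ccost (e : cexp) : nat :=
  match e with
  | CMem _ k => icost k
  | CCst _ => 0
  | CAdd e1 e2 | CSub e1 e2 | CMul e1 e2 | CDiv e1 e2 =>
      (ccost e1 + ccost e2).+1
  | CConj e1 => (ccost e1).+1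
  end%N.

Fixpoint tcost (t : test) : nat :=
  match t with
  | TLtI e1 e2 => (icost e1 + icost e2).+1
  | TLeRe e1 e2 => (ccost e1 + ccost e2).+1
  | TNot t1 => (tcost t1).+1
  end%N.

Section Execution.
Variable R : realType.
Local Notation C := R[i].
Local Notation state := (state R).

(* [exec p s c s'] : from s, the program p halts in s' at cost c. *)
Inductive exec : prog -> state -> nat -> state -> Prop :=
| exec_skip s : exec Skip s 0 s
| exec_iset x e s :
    exec (ISet x e) s (icost e).+1
      (State [eta ivar s with x |-> ieval s e] (cmem s))
| exec_cset a k e s :
    exec (CSet a k e) s (icost k + ccost e).+1
      (State (ivar s)
        (fun b j => if (b == a) && (j == ieval s k) then ceval s e
                    else cmem s b j))
| exec_seq p q s c1 s1 c2 s2 :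
    exec p s c1 s1 -> exec q s1 c2 s2 -> exec (Seq p q) s (c1 + c2) s2
| exec_if t p q s c s1 :
    exec (if teval s t then p else q) s c s1 ->
    exec (If t p q) s (tcost t + c) s1
| exec_while_false t p s :
    ~~ teval s t -> exec (While t p) s (tcost t) s
| exec_while_true t p s c1 s1 c2 s2 :
    teval s t -> exec p s c1 s1 -> exec (While t p) s1 c2 s2 ->
    exec (While t p) s (tcost t + c1 + c2) s2.

(* +oo when p does not halt. *)
Definition cost (p : prog) (s : state) : \bar R :=
  ereal_inf [set c%:R%:E | c in [set c : nat | exists s', exec p s c s']].

Variable m : nat.

(* Register 0 holds n = m.+1; array 0 holds A in row-major order, array 1 the
   vector w, cell 0 of array 2 the number zeta, cell 0 of array 3 the accuracy.
   The output is read off arrays 2 and 1. *)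
Definition input (A : 'M[C]_m.+1) (zeta : C) (w : 'cV[C]_m.+1) (eps : R) : state :=
  State (fun x => if x == 0 then m.+1 else 0)%N
    (fun a k =>
       if (a == 0) && (k < m.+1 * m.+1) then
         A (inord (k %/ m.+1)) (inord (k %% m.+1))
       else if (a == 1) && (k < m.+1) then w (inord k) ord0
       else if (a == 2) && (k == 0) then zeta
       else if (a == 3) && (k == 0) then eps%:C
       else 0%R)%N.

Definition out_zeta (s : state) : C := cmem s 2 0.

Definition out_vec (s : state) : 'cV[C]_m.+1 := \col_i cmem s 1 i.

(* Supremum over all admissible approximate eigenpairs of A; the 0 only matters
   when there is none. *)
Definition worst_cost (p : prog) (eps : R) (A : 'M[C]_m.+1) : \bar R :=
  ereal_sup ([set 0%E] `|`
    [set x | exists zeta w l v,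
       [/\ returned A zeta w, approx_eigenpair A zeta w l v
         & x = cost p (input A zeta w eps)]]).

End Execution.

Section Gaussian.
Variables (R : realType) (d : measure_display) (T : measurableType d).
Variable P : probability T R.

(* Real (b = false) or imaginary (b = true) part of the entry (i, j). *)
Definition entry_part n (A : T -> 'M[R[i]]_n) (k : 'I_n * 'I_n * bool) (t : T) : R :=
  if k.2 then complex.Im (A t k.1.1 k.1.2) else complex.Re (A t k.1.1 k.1.2).

Definition gaussian_matrix n (A : T -> 'M[R[i]]_n) : Prop :=
  [/\ forall k, measurable_fun setT (entry_part A k),
      forall k (B : set R), measurable B ->
        P (entry_part A k @^-1` B) = normal_prob 0 (Num.sqrt (1 / 2)) B
    & forall B : 'I_n * 'I_n * bool -> set R, (forall k, measurable (B k)) ->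
        P (\bigcap_k (entry_part A k @^-1` B k)) =
        (\prod_k P (entry_part A k @^-1` B k))%E].

(* Upper integral: no measurability of f is presupposed. *)
Definition upper_expectation (f : T -> \bar R) : \bar R :=
  ereal_inf [set (\int[P]_t g t)%E | g in
    [set g : T -> \bar R | measurable_fun setT g /\
                           forall t, (0 <= g t)%E /\ (f t <= g t)%E]].

End Gaussian.

Definition log2 (R : realType) (x : R) : R := ln x / ln 2.

(* Main.v *)
Require Import Defs.
From HB Require Import structures.
From mathcomp Require Import all_boot all_order all_algebra.
From mathcomp Require Import all_classical all_reals all_analysis.
From mathcomp Require Import measurable_realfun complex.
From mathcomp Require Import zify ring lra.
Set Implicit Arguments.
Unset Strict Implicit.
Unset Printing Implicit Defensive.
Import Order.TTheory GRing.Theory Num.Theory.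
Import numFieldNormedType.Exports.
Local Open Scope ring_scope.

(** Starting from an approximate eigenpair, the program applies Newton's map until
    a computable test guarantees the accuracy eps.

    Correctness.  Let F be the Frobenius norm of A, (lambda, v) the associated
    eigenpair and tau_k = (1/2)^(2^k - 1).  Clipping gives |zeta| <= F, and
    |lambda| <= F, so the initial distance is at most 6 and the k-th iterate
    (zeta_k, w_k) satisfies d_P(w_k, v) <= 6 tau_k and
    |zeta_k - lambda| <= delta_k = 6 F tau_k.  The loop stops as soon as
    2 delta_k <= eps |zeta_k|; the triangle inequality then gives
    delta_k <= eps |lambda|, which bounds the relative error and, because
    |lambda| <= F, the angle too (stop_accurate).  The test compares squares,
    as the machine has no square root.

    Newton step.  The new vector v' and the change eta of the eigenvalue span the
    kernel of the n x (n+1) matrix (A - zeta, w) (newton_projection).  The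
    orthogonal projection on this kernel is obtained from the identity by n
    rank-one corrections, one for each row, and a row that depends on the
    previous ones changes nothing (kills_rowsS).  This solves the system in
    O(n^3) operations without any pivoting.

    Number of steps.  The loop has stopped at step k if 3 delta_k <= eps |lambda|
    (refine_cost), that is, as soon as 2^(2^k) exceeds a multiple of
    F / (eps |lambda|).  Applying adj(A) A = det(A) to v bounds 1 / |lambda| by
    n max_ij |cofactor_ij| / |det A|.  The determinant is the cofactor at (i, j)
    times the sum of a_ij and a quantity independent of a_ij, whence
    |cofactor_ij| / |det A| > t has probability at most 2 / t (near_ratio_small).
    With the Gaussian tail of the entries, F and 1 / |lambda| are of order n t
    outside an event of probability O(n^2 / t) (gaussian_well_conditioned).
    Choosing t of order eps 2^(2^(k-1)) / n shows that more than
    log2 log2 (n / eps) + 4 + i steps are needed with probability O(2^-i), and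
    these probabilities are summable (average_cost). *)

(** * Reasoning about programs *)

Section ProgramLogic.
Variable R : realType.
Local Notation C := R[i].
Implicit Types (p q : prog) (s : state R) (t : test) (e : iexp) (f : cexp).

Lemma exec_seq_inv p q s c s' : exec (Seq p q) s c s' ->
  exists c1 s1 c2, exec p s c1 s1 /\ exec q s1 c2 s'.
Proof. by move=> h; inversion h; subst; do 3 eexists; split; eauto. Qed.

Lemma exec_det p s c s1 c' s2 :
  exec p s c s1 -> exec p s c' s2 -> c = c' /\ s1 = s2.
Proof.
move=> h; elim: h c' s2 => {p s c s1}.
- by move=> s c' s2 h; inversion h; subst.
- by move=> x e s c' s2 h; inversion h; subst.
- by move=> a k e s c' s2 h; inversion h; subst.
- move=> p q s c1 s1 c2 s2 _ IH1 _ IH2 c' s3 h; inversion h; subst.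
  match goal with
  | H1 : exec p _ _ _, H2 : exec q _ _ s3 |- _ =>
    by case: (IH1 _ _ H1) => ? ?; subst; case: (IH2 _ _ H2) => ? ?; subst
  end.
- move=> t p q s c s1 _ IH c' s2 h; inversion h; subst.
  by match goal with H1 : exec (if _ then _ else _) _ _ _ |- _ =>
    case: (IH _ _ H1) => ? ?; subst end.
- by move=> t p s /negP nt c' s2 h; inversion h; subst.
- move=> t p s c1 s1 c2 s2 tt _ IH1 _ IH2 c' s3 h; inversion h; subst.
    by match goal with H : is_true (~~ teval _ t) |- _ => rewrite tt in H end.
  match goal with
  | H1 : exec p _ _ _, H2 : exec (While t p) _ _ s3 |- _ =>
    by case: (IH1 _ _ H1) => ? ?; subst; case: (IH2 _ _ H2) => ? ?; subst
  end.
Qed.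

Fixpoint iwrites p : seq nat :=
  match p with
  | Skip | CSet _ _ _ => [::]
  | ISet x _ => [:: x]
  | Seq p q | If _ p q => iwrites p ++ iwrites q
  | While _ p => iwrites p
  end.

Fixpoint awrites p : seq nat :=
  match p with
  | Skip | ISet _ _ => [::]
  | CSet a _ _ => [:: a]
  | Seq p q | If _ p q => awrites p ++ awrites q
  | While _ p => awrites p
  end.

Definition agree (V A : seq nat) s s' :=
  (forall x, x \notin V -> ivar s' x = ivar s x) /\
  (forall a, a \notin A -> cmem s' a =1 cmem s a).

Lemma agree_trans V A s1 s2 s3 : agree V A s1 s2 -> agree V A s2 s3 -> agree V A s1 s3.
Proof.
move=> [h1 h2] [h3 h4]; split=> [x hx|a ha k]; first by rewrite h3// h1.
by rewrite h4// h2.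
Qed.

Lemma agree_sub V A V' A' s1 s2 :
  {subset V <= V'} -> {subset A <= A'} -> agree V A s1 s2 -> agree V' A' s1 s2.
Proof.
move=> sV sA [h1 h2]; split=> [x hx|a ha]; [apply: h1|apply: h2].
- by apply: contra hx => /sV.
- by apply: contra ha => /sA.
Qed.

(** With this, a loop invariant need only speak of the data that the loop
    assigns. *)
Lemma exec_agree p s c s' : exec p s c s' -> agree (iwrites p) (awrites p) s s'.
Proof.
elim=> {p s c s'} //=.
- move=> x e s; split=> [y|//] /=; rewrite inE => /negbTE nyx.
  by rewrite nyx.
- move=> a k e s; split=> [//|b] /=; rewrite inE => /negbTE nba j.
  by rewrite nba.
- move=> p q s c1 s1 c2 s2 _ h1 _ h2.
  by apply: (@agree_trans _ _ _ s1); [apply: agree_sub h1|apply: agree_sub h2];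
    move=> z hz; rewrite mem_cat hz ?orbT.
- move=> t p q s c s1 _; case: ifP => _; apply: agree_sub;
    by move=> z hz; rewrite mem_cat hz ?orbT.
- by move=> t p s c1 s1 c2 s2 _ _ h1 _ h2; apply: agree_trans h1 h2.
Qed.

(** Total correctness with a cost bound; as programs are deterministic, a property
    of one run is a property of every run. *)
Definition runs p s (c : nat) (Q : state R -> Prop) : Prop :=
  exists c' s', [/\ exec p s c' s', (c' <= c)%N & Q s'].

Lemma runs_weaken p s c c' (Q Q' : state R -> Prop) :
  runs p s c Q -> (c <= c')%N ->
  (forall s', agree (iwrites p) (awrites p) s s' -> Q s' -> Q' s') ->
  runs p s c' Q'.
Proof.
move=> [d [s' [h1 h2 h3]]] cc' QQ'; exists d, s'; split=> //.
- exact: leq_trans h2 cc'.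
- by apply: QQ' => //; apply: exec_agree h1.
Qed.

Lemma runs_seq p q s c1 c2 (Q1 Q : state R -> Prop) :
  runs p s c1 Q1 ->
  (forall s', agree (iwrites p) (awrites p) s s' -> Q1 s' -> runs q s' c2 Q) ->
  runs (Seq p q) s (c1 + c2) Q.
Proof.
move=> [d [s' [h1 h2 h3]]] h.
have [d' [s'' [g1 g2 g3]]] := h s' (exec_agree h1) h3.
exists (d + d')%N, s''; split=> //; first exact: exec_seq h1 g1.
exact: leq_add.
Qed.

(** Variant of [runs_seq] that spends a given budget, so that the costs of a long
    sequence are compared with the final bound one at a time. *)
Lemma runs_then p q s c1 c (Q1 Q : state R -> Prop) :
  runs p s c1 Q1 -> (c1 <= c)%N ->
  (forall s', agree (iwrites p) (awrites p) s s' -> Q1 s' -> runs q s' (c - c1) Q) ->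
  runs (Seq p q) s c Q.
Proof. by move=> h1 h2 h3; rewrite -(subnKC h2); apply: runs_seq h1 h3. Qed.

Lemma runs_iset x e s :
  runs (ISet x e) s (icost e).+1 (fun s' => ivar s' x = ieval s e).
Proof.
by do 2 eexists; split; [exact: exec_iset|by []|rewrite /= eqxx].
Qed.

Lemma runs_cset a k f s :
  runs (CSet a k f) s (icost k + ccost f).+1
    (fun s' => cmem s' a (ieval s k) = ceval s f /\
               forall j, j != ieval s k -> cmem s' a j = cmem s a j).
Proof.
do 2 eexists; split; [exact: exec_cset|by []|split=> /=].
  by rewrite !eqxx.
by move=> j /negbTE ->; rewrite andbF.
Qed.

Definition For x e p : prog :=
  Seq (ISet x (ICst 0)) (While (TLtI (IVar x) e)
    (Seq p (ISet x (IAdd (IVar x) (ICst 1))))).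

(** The invariant sees the arrays only: other registers are either the counter or
    recovered from [agree]. *)
Lemma runs_for x e p (N c : nat) (I : nat -> (nat -> nat -> C) -> Prop) s :
  x \notin iwrites p ->
  (forall s', agree (x :: iwrites p) (awrites p) s s' -> ieval s' e = N) ->
  I 0%N (cmem s) ->
  (forall i s', (i < N)%N -> agree (x :: iwrites p) (awrites p) s s' ->
    ivar s' x = i -> I i (cmem s') -> runs p s' c (fun s'' => I i.+1 (cmem s''))) ->
  runs (For x e p) s (N * (c + icost e + 3) + (icost e + 2))
    (fun s' => I N (cmem s')).
Proof.
move=> xp eN I0 Istep; set V := x :: iwrites p; set A := awrites p.
pose body := Seq p (ISet x (IAdd (IVar x) (ICst 1))).
have sub1 : {subset iwrites p <= V} by move=> z hz; rewrite inE hz orbT.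
suff loop k s0 : (k <= N)%N -> agree V A s s0 -> ivar s0 x = (N - k)%N ->
    I (N - k)%N (cmem s0) ->
    runs (While (TLtI (IVar x) e) body) s0 (k * (c + icost e + 3) + icost e + 1)
      (fun s' => I N (cmem s')).
  have -> : (N * (c + icost e + 3) + (icost e + 2) =
    1 + (N * (c + icost e + 3) + icost e + 1))%N by lia.
  apply: (runs_seq (runs_iset _ _ _)) => s' ag hx /=.
  have E : cmem s' = cmem s.
    by apply/funext => a; apply/funext => j; rewrite (proj2 ag).
  apply: loop => //; last by rewrite subnn E.
  - apply: agree_sub ag => // z; rewrite inE => /eqP ->; exact: mem_head.
  - by rewrite subnn hx.
elim: k s0 => [|k IH] s0 kN ag0 hx hI.
  exists (tcost (TLtI (IVar x) e)), s0; split => //=.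
  - by apply: exec_while_false; rewrite /= hx (eN _ ag0) subn0 ltnn.
  - lia.
  - by rewrite subn0 in hI.
have Nk : (N - k.+1 < N)%N by lia.
have [d [s1 [h1 h2 h3]]] := Istep _ _ Nk ag0 hx hI.
have ag1 := exec_agree h1.
set s2 := State [eta ivar s1 with x |-> ieval s1 (IAdd (IVar x) (ICst 1))] (cmem s1).
have ag2 : agree V A s s2.
  apply: agree_trans ag0 _; apply: (@agree_trans _ _ _ s1).
    exact: agree_sub ag1.
  by split=> [y|//]; rewrite inE negb_or => /andP[/negbTE yx _] /=; rewrite yx.
have E : (N - k = (N - k.+1).+1)%N by lia.
have [||//||d' [s3 [g1 g2 g3]]] := IH s2.
- lia.
- by [].
- by rewrite /= eqxx (proj1 ag1)// hx; lia.
- by rewrite E.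
exists (tcost (TLtI (IVar x) e) + (d + 2) + d')%N, s3; split => //.
  apply: exec_while_true g1; first by rewrite /= hx (eN _ ag0).
  by apply: exec_seq h1 _; apply: exec_iset.
by rewrite /=; lia.
Qed.

(** The new value of a cell may read the old value of this cell, as an update in
    place of a matrix does; distinctness of the cells makes this harmless. *)
Lemma runs_fill x e a k f (N : nat) (idx : nat -> nat) (F : nat -> C) s :
  (forall s', agree [:: x] [:: a] s s' -> ieval s' e = N) ->
  (forall i j, (i < N)%N -> (j < N)%N -> idx i = idx j -> i = j) ->
  (forall i s', (i < N)%N -> agree [:: x] [:: a] s s' -> ivar s' x = i ->
     ieval s' k = idx i /\
     (cmem s' a (idx i) = cmem s a (idx i) -> ceval s' f = F i)) ->
  runs (For x e (CSet a k f)) s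
    (N * ((icost k + ccost f).+1 + icost e + 3) + (icost e + 2))
    (fun s' => (forall i, (i < N)%N -> cmem s' a (idx i) = F i) /\
       (forall j, (forall i, (i < N)%N -> j <> idx i) -> cmem s' a j = cmem s a j)).
Proof.
move=> eN inj hf.
pose I n (M : nat -> nat -> C) := (n <= N)%N ->
  (forall i, (i < n)%N -> M a (idx i) = F i) /\
  (forall j, (forall i, (i < n)%N -> j <> idx i) -> M a j = cmem s a j).
apply: runs_weaken (runs_for (p := CSet a k f) (c := (icost k + ccost f).+1) (I := I) _ eN _ _) _ _; rewrite /I {I}.
- by [].
- by [].
- move=> i s' iN ag hx hI.
  have [hk hF] := hf _ _ iN ag hx.
  have [h1 h2] := hI (ltnW iN).
  have E : cmem s' a (idx i) = cmem s a (idx i).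
    by apply: h2 => l li /inj E; move: (li); rewrite E ?ltnn//; lia.
  apply: runs_weaken (runs_cset _ _ _ _) _ _ => // s'' _ [+ +] _.
  rewrite hk hF// => g1 g2; split=> [l|j hj].
    rewrite ltnS leq_eqVlt => /predU1P[->//|li].
    rewrite g2 ?h1//; apply/eqP => /inj E'; move: (li); rewrite E' ?ltnn//; lia.
  rewrite g2 ?h2// => [l li|]; first by apply: hj; lia.
  by apply/eqP; exact: hj.
- exact: leqnn.
- by move=> s' _; apply.
Qed.

Definition SumTo a k x e f : prog :=
  Seq (CSet a k (CCst 0)) (For x e (CSet a k (CAdd (CMem a k) f))).

Lemma runs_sum x e a k f (N K : nat) (F : nat -> C) s :
  (forall s', agree [:: x] [:: a] s s' -> ieval s' e = N /\ ieval s' k = K) ->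
  (forall i s', (i < N)%N -> agree [:: x] [:: a] s s' -> ivar s' x = i ->
     ceval s' f = F i) ->
  runs (SumTo a k x e f) s
    (N * (icost k + icost k + ccost f + icost e + 5) + (icost k + icost e + 3))
    (fun s' => cmem s' a K = \sum_(i < N) F i /\
       (forall j, j != K -> cmem s' a j = cmem s a j)).
Proof.
move=> eN hf.
have sk : ieval s k = K by case: (eN s).
have -> : (N * (icost k + icost k + ccost f + icost e + 5) + (icost k + icost e + 3)
  = (icost k + 0).+1 + (N * ((icost k + (icost k + ccost f).+1).+1 + icost e + 3)
     + (icost e + 2)))%N by lia.
apply: (runs_seq (runs_cset _ _ _ _)) => s1 ag1 /= [h1 h2].
have ag0 s2 : agree [:: x] [:: a] s1 s2 -> agree [:: x] [:: a] s s2.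
  by move=> h; apply: agree_trans h; apply: agree_sub ag1.
rewrite sk in h1 h2.
apply: runs_weaken (runs_for (p := CSet a k (CAdd (CMem a k) f))
  (c := (icost k + (icost k + ccost f).+1).+1) (I := fun n M => M a K = \sum_(i < n) F i /\
       (forall j, j != K -> M a j = cmem s a j)) (N := N) _ _ _ _) _ _.
- by [].
- by move=> s' /ag0 /eN [].
- by rewrite big_ord0.
- move=> i s' iN /ag0 ag hx [hI hJ].
  apply: runs_weaken (runs_cset _ _ _ _) _ _ => // s'' _ /=.
  case: (eN _ ag) => _ ->; rewrite hI (hf _ _ iN ag hx) => -[g1 g2].
  by split=> [|j jK]; rewrite ?g1 ?big_ord_recr//= g2// hJ.
- exact: leqnn.
- by [].
Qed.

Lemma while_exit t p s c s' (I : state R -> Prop) :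
  exec (While t p) s c s' -> I s ->
  (forall s1 d s2, I s1 -> teval s1 t -> exec p s1 d s2 -> I s2) ->
  I s' /\ ~~ teval s' t.
Proof.
move=> h Is step; move: h Is; move E : (While t p) => q h.
elim: h t p E step => // [t p s0 nt|t p s0 c1 s1 c2 s2 tt h1 _ _ IH] t' p' [-> ->] step //.
by move=> Is0; apply: (IH t p erefl step); apply: step h1.
Qed.

Lemma runs_while t p (c k : nat) (I : nat -> state R -> Prop) :
  (forall i s, I i s -> teval s t -> runs p s c (I i.+1)) ->
  (forall s, I k s -> ~~ teval s t) ->
  forall j i s, (i + j)%N = k -> I i s ->
  runs (While t p) s (j * (c + tcost t) + tcost t) (fun=> True).
Proof.
move=> step stop; elim=> [|j IH] i s.
  rewrite addn0 => -> /stop nt; exists (tcost t), s; split=> //.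
  exact: exec_while_false.
move=> ijk Ii; have [tt|nt] := boolP (teval s t); last first.
  by exists (tcost t), s; split=> //; [exact: exec_while_false|rewrite leq_addl].
have [d [s1 [h1 h2 h3]]] := step _ _ Ii tt.
have [|d' [s2 [g1 g2 _]]] := IH i.+1 s1 _ h3; first by rewrite -ijk; lia.
by exists (tcost t + d + d')%N, s2; split=> //; [exact: exec_while_true h1 g1|lia].
Qed.

End ProgramLogic.

(** * Kernels by orthogonal projection *)

Section KernelProjection.
Local Open Scope sesquilinear_scope.
Variable C : numClosedFieldType.

Lemma ctrmxM m n p (A : 'M[C]_(m, n)) (B : 'M[C]_(n, p)) :
  (A *m B)^t* = B^t* *m A^t*.
Proof. by rewrite trmx_mul map_mxM. Qed.

Lemma ctrmxB m n (A B : 'M[C]_(m, n)) : (A - B)^t* = A^t* - B^t*.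
Proof. by rewrite linearB /= map_mxB. Qed.

Lemma ctrmxZ m n a (A : 'M[C]_(m, n)) : (a *: A)^t* = a^* *: A^t*.
Proof. by rewrite linearZ /= map_mxZ. Qed.

Definition sqnorm n (p : 'cV[C]_n) : C := \sum_i p i 0 * (p i 0)^*.

Lemma sqnormE n (p : 'cV[C]_n) : p^t* *m p = (sqnorm p)%:M.
Proof.
rewrite [LHS]mx11_scalar; congr (_%:M); rewrite mxE; apply: eq_bigr => i _.
by rewrite !mxE mulrC.
Qed.

Lemma sqnorm_eq0 n (p : 'cV[C]_n) : sqnorm p = 0 -> p = 0.
Proof.
move=> /eqP; rewrite psumr_eq0 => [/allP h|i _]; last exact: mul_conjC_ge0.
apply/colP => i; rewrite mxE; apply/eqP.
by rewrite -mul_conjC_eq0 (implyP (h i _))// mem_index_enum.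
Qed.

Lemma conj_sqnorm n (p : 'cV[C]_n) : (sqnorm p)^* = sqnorm p.
Proof.
by rewrite rmorph_sum; apply: eq_bigr => i _; rewrite rmorphM /= conjCK mulrC.
Qed.

Definition deflate N (H : 'M[C]_N) (a : 'rV[C]_N) : 'M[C]_N :=
  H - (sqnorm (H *m a^t*))^-1 *: ((H *m a^t*) *m (H *m a^t*)^t*).

Variables (n N : nat) (M : 'M[C]_(n, N)).

(** The last clause says that 1 - H maps into the range of M^*. Once k = n, the
    four clauses make H the orthogonal projection on the kernel of M. *)
Definition kills_rows k (H : 'M[C]_N) : Prop :=
  [/\ H^t* = H, H *m H = H, forall i : 'I_n, (i < k)%N -> row i M *m H = 0
    & exists D, 1%:M - H = M^t* *m D].

Lemma kills_rows0 : kills_rows 0 1%:M.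
Proof.
split=> //.
- by rewrite trmx1 map_mx1.
- by rewrite mulmx1.
- by exists 0; rewrite mulmx0 subrr.
Qed.

(** Projecting away p = H a^* kills the row a, because a H = p^* and a p = |p|^2;
    the rows killed before annihilate p and stay killed. When p = 0 the row a is
    killed already, and the convention 0^-1 = 0 leaves H unchanged: no pivoting is
    needed. *)
Lemma kills_rowsS (k : 'I_n) H :
  kills_rows k H -> kills_rows k.+1 (deflate H (row k M)).
Proof.
move=> [hH HH h0 [D hD]]; rewrite /deflate; set a := row k M.
set p := H *m a^t*; set s := sqnorm p.
have Hp : H *m p = p by rewrite /p mulmxA HH.
have ps : p^t* = a *m H by rewrite /p ctrmxM hH trmxCK.
have ap : a *m p = s%:M.
  by rewrite -sqnormE ps -mulmxA Hp.
have pz : s = 0 -> p = 0 by exact: sqnorm_eq0.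
have pH : p^t* *m H = p^t* by rewrite ps -mulmxA HH.
split.
- by rewrite ctrmxB hH ctrmxZ ctrmxM trmxCK fmorphV /= conj_sqnorm.
- rewrite mulmxBl !mulmxBr HH -!scalemxAr -!scalemxAl mulmxA Hp.
  rewrite -[p *m p^t* *m H]mulmxA pH.
  rewrite -[p *m p^t* *m (p *m p^t*)]mulmxA [p^t* *m (p *m p^t*)]mulmxA sqnormE -/s.
  rewrite mul_scalar_mx -scalemxAr [s^-1 *: (s *: _)]scalerA.
  have [s0|s0] := eqVneq s 0; last by rewrite mulVf// scale1r subrr subr0.
  by rewrite (pz s0) mul0mx !scaler0 !subr0.
- move=> i; rewrite ltnS leq_eqVlt mulmxBr -scalemxAr mulmxA.
  case/predU1P=> [ik|ik].
    have -> : row i M = a by congr (row _ M); exact: val_inj.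
    rewrite ap mul_scalar_mx scalerA -ps.
    have [s0|s0] := eqVneq s 0; last by rewrite mulVf// scale1r subrr.
    by rewrite (pz s0) trmx0 map_mx0 scaler0 subrr.
  by rewrite h0// {1}/p mulmxA h0// !mul0mx scaler0 subrr.
- have Mp : p = M^t* *m ((delta_mx 0 k)^t* - D *m a^t*).
    rewrite mulmxBr mulmxA -hD mulmxBl mul1mx -/p -ctrmxM -rowE -/a.
    by rewrite opprB addrC subrK.
  exists (D + s^-1 *: (((delta_mx 0 k)^t* - D *m a^t*) *m p^t*)).
  rewrite mulmxDr -hD -scalemxAr mulmxA -Mp.
  by rewrite opprB addrA addrAC.
Qed.

(** If H u = 0 then u lies in the range of M^*, hence is orthogonal to every vector
    of the kernel; otherwise u^* H u = |H u|^2 is nonzero. *)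
Lemma kills_rows_ker H (u y0 : 'cV[C]_N) :
  kills_rows n H -> M *m y0 = 0 -> u^t* *m y0 <> 0 ->
  M *m (H *m u) = 0 /\ u^t* *m (H *m u) <> 0.
Proof.
move=> [hH HH h0 [D hD]] My0 uy0; split.
  apply/row_matrixP => i; rewrite row0 mulmxA !row_mul.
  by rewrite h0// mul0mx.
move=> E; apply: uy0; apply: (can_inj (@trmxCK _ _ _)).
have Hu0 : H *m u = 0.
  apply: sqnorm_eq0; have : (H *m u)^t* *m (H *m u) = 0.
    by rewrite ctrmxM hH -mulmxA (mulmxA H) HH.
  by rewrite sqnormE => /matrixP /(_ 0 0); rewrite !mxE eqxx mulr1n.
have hu : u = M^t* *m (D *m u) by rewrite mulmxA -hD mulmxBl mul1mx Hu0 subr0.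
rewrite ctrmxM trmxCK {1}hu mulmxA -ctrmxM My0 trmx0 map_mx0 mul0mx.
by rewrite !(trmx0, map_mx0).
Qed.

End KernelProjection.

Section NewtonStep.
Local Open Scope sesquilinear_scope.
Local Open Scope classical_set_scope.
Local Open Scope complex_scope.
Variable R : realType.
Local Notation C := R[i].

Variable n : nat.
Implicit Types (A : 'M[C]_n) (v w x : 'cV[C]_n) (l : C).

Lemma dotFE v w : dotF v w = (w^t* *m v) 0 0.
Proof. by rewrite /dotF [X in \tr X]mx11_scalar mxtrace_scalar mulr1n. Qed.

Lemma perpP v x : perp v x <-> v^t* *m x = 0.
Proof.
rewrite /perp /= dotFE; split=> [h|->]; last by rewrite mxE.
by rewrite [LHS]mx11_scalar h -scalemx1 scale0r.
Qed.

Lemma proj_perp_perp v x : v <> 0 -> perp v (proj_perp v x).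
Proof.
move=> v0; apply/perpP; rewrite /proj_perp mulmxBr -scalemxAr sqnormE !dotFE sqnormE.
rewrite !mxE eqxx mulr1n -scalemx1 scalerA divfK; last first.
  by apply/eqP => /sqnorm_eq0.
by rewrite scalemx1 {1}[v^t* *m x]mx11_scalar mxE subrr.
Qed.

(** Projecting DF(e, x) = (A - l) x - e w away from w removes e and leaves the
    restricted operator applied to x. *)
Lemma DFA_inj A l w : restr_invertible A l w ->
  {in [set z : C * 'cV[C]_n | perp w z.2] &, injective (DFA A l w)}.
Proof.
move=> [w0 [_ inj _]] [e1 x1] [e2 x2]; rewrite !inE /= => px1 px2 E.
have dotB x y : dotF (x - y) w = dotF x w - dotF y w.
  by rewrite !dotFE mulmxBr !mxE.
have E' : (A - l%:M) *m x1 = (A - l%:M) *m x2 + (e1 - e2) *: w.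
  move: E; rewrite /DFA /= scalerBl => /eqP; rewrite subr_eq => /eqP ->.
  by rewrite addrA addrAC.
have x12 : x1 = x2.
  suff E2 : restr A l w x1 = restr A l w x2.
    by apply: inj E2; rewrite inE.
  rewrite /restr E' /proj_perp.
  have -> : dotF ((A - l%:M) *m x2 + (e1 - e2) *: w) w =
      dotF ((A - l%:M) *m x2) w + (e1 - e2) * dotF w w.
    by rewrite !dotFE mulmxDr -scalemxAr !mxE.
  have ww : dotF w w != 0.
    by rewrite dotFE sqnormE mxE eqxx mulr1n; apply/eqP => /sqnorm_eq0.
  rewrite mulrDl mulfK// [X in _ - X]scalerDl opprD addrACA subrr addr0.
  by [].
rewrite x12; congr (_, _).
move: E'; rewrite x12 => /eqP; rewrite eq_sym addrC -subr_eq0 addrK scaler_eq0.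
by rewrite subr_eq0 => /orP[/eqP//|/eqP].
Qed.

Lemma newtonE A l w : restr_invertible A l w ->
  newton A (l, w) = Some (l - (DFA_inv A l w (FA A l w)).1,
                          w - (DFA_inv A l w (FA A l w)).2).
Proof.
move=> rA; rewrite /newton.
by rewrite asboolT; [reflexivity|exact: rA].
Qed.

(** The new vector v' and the change eta of the eigenvalue satisfy
    (A - l) v' + eta w = 0 and v' - w is orthogonal to w: the first condition puts
    (v', eta) in the kernel of (A - l, w), the second fixes its scale t. *)
Lemma newton_projection A l w (H : 'M[C]_(n + 1)) :
  restr_invertible A l w -> kills_rows (row_mx (A - l%:M) w) n H ->
  let y := H *m col_mx w (0 : 'M[C]_1) in
  let t := sqnorm w / (w^t* *m usubmx y) 0 0 in
  newton A (l, w) = Some (l - t * dsubmx y 0 0, t *: usubmx y) /\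
  t *: usubmx y <> 0.
Proof.
move=> rA kH y t; have [w0 [_ _ surj]] := rA.
have ww : sqnorm w != 0 by apply/eqP => /sqnorm_eq0.
have ker x (c : C) : row_mx (A - l%:M) w *m col_mx x c%:M =
    (A - l%:M) *m x + c *: w by rewrite mul_row_col mul_mx_scalar.
have dot0 x (c : 'M[C]_1) : (col_mx w (0 : 'M[C]_1))^t* *m col_mx x c = w^t* *m x.
  by rewrite tr_col_mx map_row_mx mul_row_col trmx0 map_mx0 mul0mx addr0.
(* the Newton equation has a solution because the restricted operator is onto *)
have [x /perpP px] := surj _ (proj_perp_perp ((A - l%:M) *m w) w0).
rewrite /restr /proj_perp; set c1 := dotF _ _ / _; set c2 := dotF _ _ / _ => E.
have [||My uy] := kills_rows_ker (u := col_mx w 0) (y0 := col_mx (w - x) (c1 - c2)%:M) kH.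
- rewrite ker mulmxBr scalerBl.
  have -> (V : zmodType) (a b c d : V) : b - a + (c - d) = (b - d) - (a - c).
    by rewrite opprB addrACA [RHS]addrACA [- d - a]addrC.
  by rewrite E subrr.
- by rewrite dot0 mulmxBr px subr0 sqnormE => /matrixP/(_ 0 0)/eqP;
    rewrite !mxE eqxx mulr1n (negbTE ww).
rewrite -/y in My uy; clearbody y; have hy : y = col_mx (usubmx y) (dsubmx y).
  by rewrite vsubmxK.
rewrite {1}hy in My; rewrite {1}hy dot0 in uy.
have wy : (w^t* *m usubmx y) 0 0 != 0.
  by apply: contra_notN uy => /eqP h; rewrite [LHS]mx11_scalar h -scalemx1 scale0r.
rewrite [dsubmx y]mx11_scalar ker in My.
have wv : w^t* *m (t *: usubmx y) = w^t* *m w.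
  rewrite -scalemxAr sqnormE [X in _ *: X]mx11_scalar.
  rewrite /t; move: wy; set d := (_ *m _) 0 0 => d0.
  by rewrite scale_scalar_mx (divfK d0).
clearbody t; split; last first.
  move=> v0; move: wv; rewrite v0 mulmx0 sqnormE => /matrixP/(_ 0 0)/eqP.
  by rewrite !mxE eqxx mulr1n eq_sym (negbTE ww).
suff E' : DFA_inv A l w (FA A l w) = (t * dsubmx y 0 0, w - t *: usubmx y).
  by rewrite (newtonE rA) E' [in LHS]/= [in LHS]subKr; reflexivity.
have -> : FA A l w = DFA A l w (t * dsubmx y 0 0, w - t *: usubmx y).
  rewrite /FA /DFA /= mulmxBr -scalemxAr -scalerA -addrA -opprD -scalerDr My.
  by rewrite scaler0 subr0.
apply: pinvKV; first exact: DFA_inj.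
by rewrite inE; apply/perpP; rewrite mulmxBr wv subrr.
Qed.

End NewtonStep.

(** * A program for the Newton step *)

(** Arrays 0 to 3 hold the input; array 4 the square of the Frobenius norm of A and
    array 5 the current rate (1/2)^(2^k - 1), both in cell 0. The Newton step works
    in array 6 (the projection H, in row-major order with n+1 columns), 7 (a row a
    of (A - zeta, w)), 8 (the vector p = H a^* of [deflate]), 9 (the number |p|^2),
    10 (the vector y = H (w, 0)), 11 and 12 (the scale t and its denominator).
    Register 1 holds n + 1. *)
Definition I0 := ICst 0.
Definition rn := IVar 0.
Definition rN := IVar 1.
Definition rk := IVar 2.
Definition ri := IVar 3.
Definition rj := IVar 4.
Definition cellH : iexp := IAdd (IMul ri rN) rj.

Definition matvec_prog (b : nat) (e : iexp) (f : cexp) : prog :=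
  For 3 rN (SumTo b ri 4 e (CMul (CMem 6 cellH) f)).

Definition row_prog : prog :=
  Seq (For 3 rn (CSet 7 ri (CMem 0 (IAdd (IMul rk rn) ri))))
  (Seq (CSet 7 rk (CSub (CMem 7 rk) (CMem 2 I0)))
       (CSet 7 rn (CMem 1 rk))).

Definition deflate_prog : prog :=
  Seq (matvec_prog 8 rN (CConj (CMem 7 rj)))
  (Seq (SumTo 9 I0 3 rN (CMul (CMem 8 ri) (CConj (CMem 8 ri))))
       (For 3 rN (For 4 rN (CSet 6 cellH
          (CSub (CMem 6 cellH)
             (CDiv (CMul (CMem 8 ri) (CConj (CMem 8 rj))) (CMem 9 I0))))))).

Definition identity_prog : prog :=
  Seq (For 3 (IMul rN rN) (CSet 6 ri (CCst 0)))
      (For 3 rN (CSet 6 (IAdd (IMul ri rN) ri) (CCst 1))).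

Definition kernel_prog : prog :=
  Seq identity_prog (For 2 rn (Seq row_prog deflate_prog)).

Definition update_prog : prog :=
  Seq (matvec_prog 10 rn (CMem 1 rj))
  (Seq (SumTo 11 I0 3 rn (CMul (CMem 1 ri) (CConj (CMem 1 ri))))
  (Seq (SumTo 12 I0 3 rn (CMul (CConj (CMem 1 ri)) (CMem 10 ri)))
  (Seq (CSet 11 I0 (CDiv (CMem 11 I0) (CMem 12 I0)))
  (Seq (For 3 rn (CSet 1 ri (CMul (CMem 11 I0) (CMem 10 ri))))
       (CSet 2 I0 (CSub (CMem 2 I0) (CMul (CMem 11 I0) (CMem 10 rn)))))))).

Definition newton_prog : prog := Seq kernel_prog update_prog.

Section NewtonProgram.
Local Open Scope sesquilinear_scope.
Local Open Scope complex_scope.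
Variable R : realType.
Local Notation C := R[i].
Implicit Types s : state R.

Ltac subl := by move=> ?; rewrite /= ?inE; lia.

Lemma flat_inj N i j k l : (j < N)%N -> (l < N)%N ->
  (i * N + j = k * N + l)%N -> i = k /\ j = l.
Proof.
move=> jN lN E; have := congr1 (modn^~ N) E; rewrite /= !modnMDl !modn_small// => jl.
split=> //; move: E; rewrite jl => /addIn/eqP; rewrite eqn_mul2r => /orP[|/eqP//].
by move=> /eqP N0; rewrite N0 in jN.
Qed.

Lemma runs_matvec b e f N M (F : nat -> C) s :
  ivar s 1%N = N -> b != 6%N ->
  (forall s', agree [:: 3; 4]%N [:: b] s s' -> ieval s' e = M) ->
  (forall s' j, (j < M)%N -> agree [:: 3; 4]%N [:: b] s s' -> ivar s' 4%N = j ->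
     ceval s' f = F j) ->
  runs (matvec_prog b e f) s
    (N * (M * (ccost f + icost e + 8) + icost e + 6) + 2)%N
    (fun s' => forall i, (i < N)%N ->
       cmem s' b i = \sum_(j < M) cmem s 6 (i * N + j) * F j).
Proof.
move=> sN b6 he hf; rewrite /matvec_prog; set body := SumTo _ _ _ _ _.
have sub s' : agree (3 :: iwrites body) (awrites body) s s' ->
    agree [:: 3; 4]%N [:: b] s s' by apply: agree_sub; subl.
apply: runs_weaken (runs_for (p := body) (N := N) (I := fun k D => forall i, (i < k)%N ->
       D b i = \sum_(j < M) cmem s 6 (i * N + j) * F j)
   (c := (M * (0 + 0 + (2 + ccost f).+1 + icost e + 5) + (0 + icost e + 3))%N) _ _ _ _) _ _.
- by [].
- by move=> s' /sub ag; rewrite /= (proj1 ag).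
- by [].
- move=> i s' iN /sub ag xi hI.
  apply: runs_weaken (runs_sum (N := M) (K := i)
    (F := fun j => cmem s 6 (i * N + j) * F j) _ _) _ _.
  + move=> s2 ag2; split; first by apply: he; apply: agree_trans ag _; apply: agree_sub ag2; subl.
    by rewrite /= (proj1 ag2).
  + move=> j s2 jM ag2 xj.
    have ag3 : agree [:: 3; 4]%N [:: b] s s2.
      by apply: agree_trans ag _; apply: agree_sub ag2; subl.
    rewrite /= (hf _ _ jM ag3 xj) (proj2 ag3); last by rewrite inE eq_sym.
    by rewrite (proj1 ag3 1%N)// sN xj (proj1 ag2)// xi.
  + by rewrite /=; nia.
  + move=> s2 _ [h1 h2] l; rewrite ltnS leq_eqVlt => /predU1P[->//|li].
    by rewrite h2 ?hI//; apply/eqP => E; move: li; rewrite E ltnn.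
- by rewrite /=; nia.
- by [].
Qed.

Variable n : nat.

Record holds (A : 'M[C]_n) (l : C) (w : 'cV[C]_n) s : Prop := Holds {
  holds_n : ivar s 0%N = n;
  holds_N : ivar s 1%N = n.+1;
  holds_A : forall i j : 'I_n, cmem s 0 (i * n + j) = A i j;
  holds_w : forall i : 'I_n, cmem s 1 i = w i 0;
  holds_l : cmem s 2 0 = l }.

Lemma holds_agree V W A l w s s' :
  agree V W s s' -> all (fun x => x \notin V) [:: 0; 1]%N ->
  all (fun a => a \notin W) [:: 0; 1; 2]%N -> holds A l w s -> holds A l w s'.
Proof.
move=> [h1 h2] /= /and3P[v0 v1 _] /and4P[w0 w1 w2 _] [g1 g2 g3 g4 g5].
by split=> *; rewrite ?h1 ?h2.
Qed.

Definition arrayH s : 'M[C]_(n + 1) := \matrix_(i, j) cmem s 6 (i * n.+1 + j).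

Lemma arrayH_agree V W s s' : agree V W s s' -> 6%N \notin W -> arrayH s' = arrayH s.
Proof. by move=> [_ ag] h; apply/matrixP => i j; rewrite !mxE ag. Qed.

Lemma runs_row A l w s (k : 'I_n) : holds A l w s -> ivar s 2%N = k ->
  runs row_prog s (20 * n.+1)%N
    (fun s' => forall j : 'I_(n + 1), cmem s' 7 j = row_mx (A - l%:M) w k j).
Proof.
move=> hs sk; rewrite /row_prog.
have kn := ltn_ord k; case: (hs) => sn sN sA sw sl.
apply: (runs_then (runs_fill (N := n) (idx := id)
  (F := fun j => cmem s 0 (k * n + j)) _ _ _)).
- by move=> s' ag; rewrite /= (proj1 ag).
- by [].
- move=> i s' _ ag xi; split=> //= _; rewrite xi !(proj1 ag)// sk sn.
  by rewrite (proj2 ag).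
- by rewrite /=; lia.
move=> s1 ag1 [h1 _].
apply: (runs_then (runs_cset 7 rk _ s1)); first by rewrite /=; lia.
move=> s2 ag2 /=; rewrite (proj1 ag1)// sk => -[h2 h2'].
apply: runs_weaken (runs_cset 7 rn _ s2) _ _; first by rewrite /=; lia.
move=> s3 _ /=; rewrite !(proj1 ag2)// !(proj1 ag1)// sk sn => -[h3 h3'] j.
case: (split_ordP j) => {}j ->.
  rewrite row_mxEl !mxE /= h3'; last by rewrite neq_ltn ltn_ord.
  have [kj|jk] := eqVneq k j.
    by rewrite -kj h2 h1//= sA (proj2 ag1)// sl ?eqxx ?mulr1n.
  by rewrite h2' ?h1//= ?sA ?mulr0n ?subr0// eq_sym.
rewrite row_mxEr ord1 /= addn0 h3 (proj2 ag2)// (proj2 ag1)//.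
Qed.

Lemma runs_deflate s (a : 'rV[C]_(n + 1)) :
  ivar s 1%N = n.+1 -> (forall j : 'I_(n + 1), cmem s 7 j = a 0 j) ->
  runs deflate_prog s (100 * n.+1 ^ 2)%N
    (fun s' => arrayH s' = deflate (arrayH s) a).
Proof.
move=> sN sa; set p := arrayH s *m a^t*.
have n1 : (n + 1 = n.+1)%N by rewrite addn1.
apply: (runs_then (runs_matvec (N := n.+1) (M := n.+1) (F := fun j => (cmem s 7 j)^*) _ _ _ _)).
- by [].
- by [].
- by move=> s' ag; rewrite /= (proj1 ag).
- by move=> s' j jN ag xj; rewrite /= xj (proj2 ag).
- by rewrite /=; nia.
move=> s1 ag1 h1.
have hp (i : 'I_(n + 1)) : cmem s1 8 i = p i 0.
  have iN : (i < n.+1)%N by rewrite -n1.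
  rewrite h1// mxE -(big_mkord xpredT (fun j => cmem s 6 (i * n.+1 + j) * (cmem s 7 j)^*)).
  by rewrite -{1}n1 big_mkord; apply: eq_bigr => j _; rewrite !mxE sa.
have hpn i (iN : (i < n + 1)%N) : cmem s1 8 i = p (Ordinal iN) 0 by rewrite -hp.
apply: (runs_then (runs_sum (N := n.+1) (K := 0%N)
  (F := fun j => cmem s1 8 j * (cmem s1 8 j)^*) _ _)).
- by move=> s' ag; split; rewrite //= (proj1 ag)// (proj1 ag1).
- by move=> i s' iN ag xi; rewrite /= xi (proj2 ag).
- by rewrite /=; nia.
move=> s2 ag2 [h2 _].
have {}h2 : cmem s2 9 0 = sqnorm p.
  rewrite h2 -(big_mkord xpredT (fun j => cmem s1 8 j * (cmem s1 8 j)^*)).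
  by rewrite -{1}n1 big_mkord; apply: eq_bigr => j _; rewrite !hp.
have ag02 : agree [:: 3; 4]%N [:: 8; 9]%N s s2.
  apply: (@agree_trans _ _ _ _ s1).
    by apply: agree_sub ag1; subl.
  by apply: agree_sub ag2; subl.
have p2 : cmem s2 8 =1 cmem s1 8 by apply: (proj2 ag2).
pose E i j := cmem s 6 (i * n.+1 + j) - cmem s1 8 i * (cmem s1 8 j)^* / sqnorm p.
pose inner := For 4 rN (CSet 6 cellH
          (CSub (CMem 6 cellH)
             (CDiv (CMul (CMem 8 ri) (CConj (CMem 8 rj))) (CMem 9 I0)))).
apply: runs_weaken (runs_for (p := inner) (N := n.+1) (c := 20 * n.+1) (I := fun k D =>
  forall i j, (i < n.+1)%N -> (j < n.+1)%N ->
    D 6%N (i * n.+1 + j)%N = if (i < k)%N then E i j else cmem s 6 (i * n.+1 + j)) _ _ _ _) _ _.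
- by [].
- by move=> s' ag; rewrite /= (proj1 ag)// (proj1 ag02).
- by move=> i j _ _; rewrite (proj2 ag02).
- move=> i s3 iN ag3 xi hI.
  apply: runs_weaken (runs_fill (N := n.+1) (idx := fun j => (i * n.+1 + j)%N)
    (F := E i) _ _ _) _ _.
  + by move=> s' ag; rewrite /= (proj1 ag)// (proj1 ag3)// (proj1 ag02).
  + by move=> j l _ _ /addnI.
  + move=> j s' jN ag xj; rewrite /= xj !(proj1 ag)// xi (proj1 ag3)//.
    rewrite (proj1 ag02)// sN; split=> // ->.
    rewrite hI// ltnn !(proj2 ag)// !(proj2 ag3)// h2 !p2.
    by [].
  + by rewrite /=; lia.
  + move=> s' _ [g1 g2] i' j i'N jN; rewrite ltnS leq_eqVlt.
    have [->|ii] /= := eqVneq i' i; first by rewrite g1.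
    rewrite g2 ?hI// => l lN /flat_inj[]// iE _.
    by rewrite iE eqxx in ii.
- by rewrite /=; nia.
move=> s' _ h; apply/matrixP => i j.
have iN : (i < n.+1)%N by rewrite -n1.
have jN : (j < n.+1)%N by rewrite -n1.
rewrite mxE h// iN /E !hp /deflate -/p [in RHS]mxE [RHS]addrC !mxE big_ord1 !mxE.
by rewrite addrC; congr (_ - _); rewrite [RHS]mulrC.
Qed.

Lemma runs_identity s :
  ivar s 1%N = n.+1 ->
  runs identity_prog s (20 * n.+1 ^ 2)%N (fun s' => arrayH s' = 1%:M).
Proof.
move=> sN.
apply: (runs_then (runs_fill (N := (n.+1 * n.+1)%N) (idx := id) (F := fun=> 0) _ _ _)).
- by move=> s' ag; rewrite /= (proj1 ag)// sN.
- by [].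
- by move=> i s' _ ag xi; split.
- by rewrite /=; nia.
move=> s1 ag1 [h1 _].
apply: runs_weaken (runs_fill (N := n.+1) (idx := fun i => (i * n.+1 + i)%N)
  (F := fun=> 1) _ _ _) _ _.
- by move=> s' ag; rewrite /= (proj1 ag)// (proj1 ag1).
- by move=> i j iN jN /flat_inj[].
- by move=> i s' _ ag xi; rewrite /= xi (proj1 ag)// (proj1 ag1)// sN.
- by rewrite /=; nia.
move=> s2 _ [h2 h2']; apply/matrixP => i j; rewrite !mxE.
have iN : (i < n.+1)%N by rewrite -[n.+1]addn1.
have jN : (j < n.+1)%N by rewrite -[n.+1]addn1.
have [->|ij] := eqVneq i j; first by rewrite h2.
rewrite h2' ?h1//; first by nia.
move=> k kN /flat_inj[]// iE jE; apply: (negP ij); apply/eqP/val_inj.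
by rewrite /= iE jE.
Qed.

Lemma runs_kernel A l w s : holds A l w s ->
  runs kernel_prog s (200 * n.+1 ^ 3)%N
    (fun s' => kills_rows (row_mx (A - l%:M) w) n (arrayH s')).
Proof.
move=> hs.
apply: (runs_then (runs_identity (holds_N hs))); first by nia.
move=> s1 ag1 h1.
have hs1 := holds_agree ag1 isT isT hs.
pose body := Seq row_prog deflate_prog.
apply: runs_weaken (runs_for (p := body) (N := n) (c := 120 * n.+1 ^ 2)
  (I := fun k D => exists2 s', cmem s' = D &
          kills_rows (row_mx (A - l%:M) w) k (arrayH s')) _ _ _ _) _ _.
- by [].
- by move=> s' ag; rewrite /= (proj1 ag)// (holds_n hs1).
- by exists s1 => //; rewrite h1; apply: kills_rows0.
- move=> i s2 iN ag2 xi [s2' Es2 hI].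
  have hs2 := holds_agree ag2 isT isT hs1.
  have {}hI : kills_rows (row_mx (A - l%:M) w) i (arrayH s2).
    by move: hI; rewrite /arrayH Es2.
  apply: (runs_then (runs_row (k := Ordinal iN) hs2 xi)); first by nia.
  move=> s3 ag3 h3; have hs3 := holds_agree ag3 isT isT hs2.
  apply: runs_weaken (runs_deflate (a := row (Ordinal iN) (row_mx (A - l%:M) w))
    (holds_N hs3) _) _ _.
  + by move=> j; rewrite h3 [RHS]mxE.
  + by nia.
  + move=> s4 _ h4; exists s4; first reflexivity.
    rewrite h4 (arrayH_agree ag3 isT).
    exact: (kills_rowsS (k := Ordinal iN) hI).
- by rewrite /=; nia.
- by move=> s' _ [s2 E]; rewrite /arrayH E.
Qed.

Lemma runs_update A l w s (H := arrayH s) (y := H *m col_mx w (0 : 'M[C]_1))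
    (t := sqnorm w / (w^t* *m usubmx y) 0 0) :
  holds A l w s ->
  runs update_prog s (60 * n.+1 ^ 2)%N
    (holds A (l - t * dsubmx y 0 0) (t *: usubmx y)).
Proof.
move=> hs; case: (hs) => sn sN sA sw sl; rewrite /update_prog.
have n1 : (n + 1 = n.+1)%N by rewrite addn1.
apply: (runs_then (runs_matvec (N := n.+1) (M := n) (F := cmem s 1) _ _ _ _)).
- by [].
- by [].
- by move=> s' ag; rewrite /= (proj1 ag).
- by move=> s' j jN ag xj; rewrite /= xj (proj2 ag).
- by rewrite /=; nia.
move=> s1 ag1 h1; case: (holds_agree ag1 isT isT hs) => s1n s1N s1A s1w s1l.
have hy (i : 'I_(n + 1)) : cmem s1 10 i = y i 0.
  have iN : (i < n.+1)%N by rewrite -n1.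
  rewrite h1// mxE big_split_ord /= [X in _ = _ + X]big1 ?addr0; last first.
    by move=> j _; rewrite col_mxEd [X in _ * X]mxE mulr0.
  by apply: eq_bigr => j _; rewrite col_mxEu mxE sw.
apply: (runs_then (runs_sum (N := n) (K := 0%N)
  (F := fun j => cmem s1 1 j * (cmem s1 1 j)^*) _ _)).
- by move=> s' ag; rewrite /= (proj1 ag).
- by move=> i s' _ ag xi; rewrite /= xi (proj2 ag).
- by rewrite /=; nia.
move=> s2 ag2 [h2 _]; case: (holds_agree ag2 isT isT (Holds s1n s1N s1A s1w s1l)).
move=> s2n s2N s2A s2w s2l.
have {}h2 : cmem s2 11 0 = sqnorm w by rewrite h2; apply: eq_bigr => j _; rewrite s1w.
apply: (runs_then (runs_sum (N := n) (K := 0%N)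
  (F := fun j => (cmem s2 1 j)^* * cmem s2 10 j) _ _)).
- by move=> s' ag; rewrite /= (proj1 ag).
- by move=> i s' _ ag xi; rewrite /= xi !(proj2 ag).
- by rewrite /=; nia.
move=> s3 ag3 [h3 _]; case: (holds_agree ag3 isT isT (Holds s2n s2N s2A s2w s2l)).
move=> s3n s3N s3A s3w s3l.
have y2 : cmem s2 10 =1 cmem s1 10 by apply: (proj2 ag2).
have {}h3 : cmem s3 12 0 = (w^t* *m usubmx y) 0 0.
  rewrite h3 mxE; apply: eq_bigr => j _; rewrite s2w y2.
  have -> : cmem s1 10 j = y (lshift 1 j) 0 by rewrite -hy.
  by rewrite !mxE.
apply: (runs_then (runs_cset 11 I0 _ s3)); first by rewrite /=; nia.
move=> s4 ag4 /=; rewrite h3 (proj2 ag3)// h2 -/t => -[h4 _].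
case: (holds_agree ag4 isT isT (Holds s3n s3N s3A s3w s3l)).
move=> s4n s4N s4A s4w s4l.
have y4 i : cmem s4 10 i = cmem s1 10 i by rewrite (proj2 ag4)// (proj2 ag3).
apply: (runs_then (runs_fill (N := n) (idx := id) (F := fun i => t * cmem s1 10 i) _ _ _)).
- by move=> s' ag; rewrite /= (proj1 ag).
- by [].
- by move=> i s' _ ag xi; split=> //= _; rewrite xi !(proj2 ag)// h4 y4.
- by rewrite /=; nia.
move=> s5 ag5 [h5 _].
apply: runs_weaken (runs_cset 2 I0 _ s5) _ _; first by rewrite /=; nia.
move=> s6 ag6 /= [h6 h6'].
have y5 i : cmem s5 10 i = cmem s1 10 i by rewrite (proj2 ag5).
split.
- by rewrite (proj1 ag6)// (proj1 ag5).
- by rewrite (proj1 ag6)// (proj1 ag5).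
- by move=> i j; rewrite (proj2 ag6)// (proj2 ag5).
- move=> i; rewrite (proj2 ag6)// h5//.
  have -> : cmem s1 10 i = y (lshift 1 i) 0 by rewrite -hy.
  by rewrite [RHS]mxE [usubmx y i 0]mxE.
- rewrite h6 !(proj2 ag5)// h4 s4l (proj1 ag5)// s4n y4.
  have -> : cmem s1 10 n = y (rshift n 0) 0 by rewrite -hy /= addn0.
  by rewrite [dsubmx y 0 0]mxE.
Qed.

Lemma newton_defined (A : 'M[C]_n) l w l1 w1 :
  newton A (l, w) = Some (l1, w1) -> restr_invertible A l w.
Proof. by rewrite /newton; case: asboolP. Qed.

Lemma runs_newton (A : 'M[C]_n) l w l1 w1 s : holds A l w s -> newton A (l, w) = Some (l1, w1) ->
  runs newton_prog s (260 * n.+1 ^ 3)%N (holds A l1 w1).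
Proof.
move=> hs nE.
apply: (runs_then (runs_kernel hs)); first by nia.
move=> s1 ag1 h1; have hs1 := holds_agree ag1 isT isT hs.
have [] := newton_projection (newton_defined nE) h1.
rewrite nE => -[-> ->] _.
by apply: runs_weaken (runs_update hs1) _ _ => //; nia.
Qed.

End NewtonProgram.

(** * Norms and eigenvalues *)

Section Norms.
Local Open Scope sesquilinear_scope.
Local Open Scope complex_scope.
Variable R : realType.
Local Notation C := R[i].

Lemma cabsE (z : C) : (cabs z)%:C = `|z|.
Proof. by rewrite /cabs RRe_real// normr_real. Qed.

Lemma cabs_ge0 (z : C) : 0 <= cabs z.
Proof. by rewrite -ler0c cabsE. Qed.

Lemma cabsM (x y : C) : cabs (x * y) = cabs x * cabs y.
Proof. by apply: complexI; rewrite rmorphM /= !cabsE normrM. Qed.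

Lemma cabsD (x y : C) : cabs (x + y) <= cabs x + cabs y.
Proof. by rewrite -lecR rmorphD /= !cabsE ler_normD. Qed.

Lemma cabsN (x : C) : cabs (- x) = cabs x.
Proof. by apply: complexI; rewrite !cabsE normrN. Qed.

Lemma cabs0 : cabs (0 : C) = 0.
Proof. by apply: complexI; rewrite cabsE normr0. Qed.

Lemma cabs_eq0 (x : C) : cabs x = 0 -> x = 0.
Proof. by move=> h; apply: normr0_eq0; rewrite -cabsE h. Qed.

Lemma cabs_gt0 (x : C) : x <> 0 -> 0 < cabs x.
Proof. by move=> x0; rewrite lt_def cabs_ge0 andbT; apply/eqP => /cabs_eq0. Qed.

Lemma cabs_real (x : R) : 0 <= x -> cabs x%:C = x.
Proof. by move=> x0; apply: complexI; rewrite cabsE ger0_norm// ler0c. Qed.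

Lemma cabs_sqr (z : C) : (cabs z ^+ 2)%:C = z * z^*.
Proof. by rewrite rmorphXn /= cabsE normCK. Qed.

Lemma cabs_sqr_ReIm (z : C) : cabs z ^+ 2 = complex.Re z ^+ 2 + complex.Im z ^+ 2.
Proof. by apply: complexI; rewrite add_Re2_Im2 rmorphXn /= cabsE. Qed.

Lemma Re_le_cabs (z : C) : `|complex.Re z| <= cabs z.
Proof.
rewrite -(@ler_pXn2r _ 2)// ?nnegrE ?cabs_ge0 ?normr_ge0//.
by rewrite real_normK ?num_real// cabs_sqr_ReIm lerDl sqr_ge0.
Qed.

Lemma cabs_le_Re_Im (z : C) t : `|complex.Re z| <= t -> `|complex.Im z| <= t ->
  cabs z <= 2 * t.
Proof.
move=> h1 h2; have t0 : 0 <= t by apply: le_trans h1.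
rewrite -(@ler_pXn2r _ 2)// ?nnegrE ?cabs_ge0 ?mulr_ge0// cabs_sqr_ReIm.
have sq (x : R) : `|x| <= t -> x ^+ 2 <= t ^+ 2.
  by move=> h; rewrite -(real_normK (num_real x)) ler_pXn2r ?nnegrE.
by have := sq _ h1; have := sq _ h2; nra.
Qed.

Lemma cabs_sum (I : Type) (r : seq I) (F : I -> C) :
  cabs (\sum_(i <- r) F i) <= \sum_(i <- r) cabs (F i).
Proof.
elim/big_rec2 : _ => [|i x y _ h]; first by rewrite cabs0.
by apply: le_trans (cabsD _ _) _; rewrite lerD2l.
Qed.

Lemma cabsV (x : C) : cabs x^-1 = (cabs x)^-1.
Proof. by apply: complexI; rewrite cabsE normfV -cabsE fmorphV. Qed.

(** Lagrange's identity. *)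
Lemma cauchy_schwarz_sum (I : finType) (x y : I -> R) :
  (\sum_i x i * y i) ^+ 2 <= (\sum_i x i ^+ 2) * (\sum_i y i ^+ 2).
Proof.
have : 0 <= \sum_i \sum_j (x i * y j - x j * y i) ^+ 2.
  by apply: sumr_ge0 => i _; apply: sumr_ge0 => j _; exact: sqr_ge0.
set P := _ * _; set S := \sum_i x i * y i.
have -> : \sum_i \sum_j (x i * y j - x j * y i) ^+ 2 = P + P - S ^+ 2 *+ 2.
  have PE : P = \sum_i \sum_j x i ^+ 2 * y j ^+ 2.
    by rewrite /P mulr_suml; apply: eq_bigr => i _; rewrite mulr_sumr.
  have PE' : P = \sum_i \sum_j x j ^+ 2 * y i ^+ 2 by rewrite PE exchange_big.
  have SE : S ^+ 2 = \sum_i \sum_j (x i * y i) * (x j * y j).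
    by rewrite expr2 {1}/S mulr_suml; apply: eq_bigr => i _; rewrite mulr_sumr.
  rewrite {1}PE PE' SE -sumrMnl -big_split -sumrB; apply: eq_bigr => i _ /=.
  rewrite -sumrMnl -big_split -sumrB; apply: eq_bigr => j _ /=; ring.
lra.
Qed.

Lemma normF_sqr p q (A : 'M[C]_(p, q)) :
  normF A ^+ 2 = \sum_i \sum_j cabs (A i j) ^+ 2.
Proof.
have E : dotF A A = (\sum_i \sum_j cabs (A i j) ^+ 2)%:C.
  rewrite /dotF /mxtrace; under eq_bigr do rewrite mxE.
  rewrite exchange_big /= rmorph_sum; apply: eq_bigr => i _.
  rewrite rmorph_sum; apply: eq_bigr => j _.
  by rewrite /= cabs_sqr !mxE mulrC.
rewrite /normF E sqr_sqrtr//=.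
by apply: sumr_ge0 => i _; apply: sumr_ge0 => j _; exact: sqr_ge0.
Qed.

Lemma normF_ge0 p q (A : 'M[C]_(p, q)) : 0 <= normF A.
Proof. exact: sqrtr_ge0. Qed.

Lemma cabs_le_normF p q (A : 'M[C]_(p, q)) i j : cabs (A i j) <= normF A.
Proof.
rewrite -(@ler_pXn2r _ 2)// ?nnegrE ?cabs_ge0 ?normF_ge0//.
rewrite normF_sqr (bigD1 i)//= (bigD1 j)//= -addrA lerDl addr_ge0//.
  by apply: sumr_ge0 => k _; exact: sqr_ge0.
by apply: sumr_ge0 => k _; apply: sumr_ge0 => l _; exact: sqr_ge0.
Qed.

Lemma normF_gt0 p q (A : 'M[C]_(p, q)) : A <> 0 -> 0 < normF A.
Proof.
move=> A0; rewrite lt_def normF_ge0 andbT; apply/eqP => h; apply: A0.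
apply/matrixP => i j; rewrite mxE; apply: cabs_eq0; apply/eqP.
by rewrite eq_le cabs_ge0 andbT -h cabs_le_normF.
Qed.

Variable n : nat.

Lemma eigenvalue_le_normF (A : 'M[C]_n) (v : 'cV[C]_n) l :
  A *m v = l *: v -> v <> 0 -> cabs l <= normF A.
Proof.
move=> Av v0; have V0 := normF_gt0 v0.
have V2 : normF v ^+ 2 = \sum_i cabs (v i 0) ^+ 2.
  by rewrite normF_sqr; apply: eq_bigr => i _; rewrite big_ord1.
have row i : cabs l ^+ 2 * cabs (v i 0) ^+ 2 <=
    (\sum_j cabs (A i j) ^+ 2) * normF v ^+ 2.
  rewrite V2 -exprMn -cabsM.
  have -> : l * v i 0 = \sum_j A i j * v j 0.
    by move/matrixP : Av => /(_ i 0); rewrite !mxE.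
  apply: le_trans (cauchy_schwarz_sum (fun j => cabs (A i j)) (fun j => cabs (v j 0))).
  rewrite ler_pXn2r ?nnegrE ?cabs_ge0//; last first.
    by apply: sumr_ge0 => j _; rewrite mulr_ge0 ?cabs_ge0.
  by apply: le_trans (cabs_sum _ _) _; apply: ler_sum => j _; rewrite cabsM.
rewrite -(@ler_pXn2r _ 2)// ?nnegrE ?cabs_ge0 ?normF_ge0//.
rewrite -(@ler_pM2r _ (normF v ^+ 2)) ?exprn_gt0//.
rewrite {1}V2 mulr_sumr (normF_sqr A) mulr_suml.
by apply: ler_sum => i _; exact: row.
Qed.

(** [acos] takes its values in [0, pi] even outside [-1, 1], where it is 0. *)
Lemma dP_ge0 (v w : 'cV[C]_n) : 0 <= dP v w.
Proof.
rewrite /dP acos.unlock; case: (pselect (exists y : R, 0 <= y <= pi /\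
    cos y = cabs (dotF v w) / (normF v * normF w))) => h.
  by case: (@getPex _ (fun y : R => 0 <= y <= pi /\ _) h) => /andP[].
by rewrite getPN// => y hy; apply: h; exists y.
Qed.

Lemma dP_le4 (v w : 'cV[C]_n) : dP v w <= 4.
Proof.
have pi4 : (pi : R) <= 4 by have := @pihalf_lt2 R; lra.
rewrite /dP acos.unlock; case: (pselect (exists y : R, 0 <= y <= pi /\
    cos y = cabs (dotF v w) / (normF v * normF w))) => h.
  case: (@getPex _ (fun y : R => 0 <= y <= pi /\ _) h) => /andP[_ h2] _.
  exact: le_trans h2 pi4.
by rewrite getPN// => y hy; apply: h; exists y.
Qed.

Lemma dist_le_fst (A : 'M[C]_n) (z z' : C * 'cV[C]_n) : A <> 0 ->
  cabs (z.1 - z'.1) <= normF A * dist_pair A z z'.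
Proof.
move=> A0; have F0 := normF_gt0 A0.
rewrite -ler_pdivrMl// /dist_pair mulrC.
rewrite -[X in X <= _]ger0_norm; last by rewrite divr_ge0 ?cabs_ge0 ?ltW.
by rewrite -sqrtr_sqr ler_wsqrtr// expr_div_n lerDl sqr_ge0.
Qed.

Lemma dist_le_snd (A : 'M[C]_n) (z z' : C * 'cV[C]_n) :
  dP z.2 z'.2 <= dist_pair A z z'.
Proof.
rewrite -[X in X <= _]ger0_norm ?dP_ge0// -sqrtr_sqr ler_wsqrtr//.
by rewrite lerDr divr_ge0 ?sqr_ge0.
Qed.

Lemma dist_le6 (A : 'M[C]_n) (z z' : C * 'cV[C]_n) : A <> 0 ->
  cabs z.1 <= normF A -> cabs z'.1 <= normF A -> dist_pair A z z' <= 6.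
Proof.
move=> A0 h h'; have F0 := normF_gt0 A0.
have E : (6 : R) = Num.sqrt (6 ^+ 2) by rewrite sqrtr_sqr ger0_norm.
rewrite E ler_wsqrtr// -expr_div_n.
have : cabs (z.1 - z'.1) / normF A <= 2.
  rewrite ler_pdivrMr//; apply: le_trans (cabsD _ _) _; rewrite cabsN.
  by rewrite mulr_natl mulr2n lerD.
have := dP_le4 z.2 z'.2; have := dP_ge0 z.2 z'.2.
have : 0 <= cabs (z.1 - z'.1) / normF A by rewrite divr_ge0 ?cabs_ge0 ?ltW.
nra.
Qed.

End Norms.

Section Returned.
Variable R : realType.
Local Notation C := R[i].
Local Open Scope complex_scope.

Lemma cabs_clip (z : C) : cabs (clip z) <= 1.
Proof.
rewrite /clip; case: ltP => // h; rewrite cabsM cabsV cabs_real ?cabs_ge0//.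
by rewrite divff// gt_eqF// (lt_trans ltr01).
Qed.

(** Clipping keeps the eigenvalue component of the normalised problem in the unit
    disc; the hypothesis on zeta0 covers the case in which the loop makes no step. *)
Lemma path_follow_bound n (A A0 : 'M[C]_n) zeta0 w0 zeta w :
  path_follow A A0 zeta0 w0 zeta w -> cabs zeta0 <= normF A0 ->
  A <> 0 /\ cabs zeta <= normF A.
Proof.
move=> [An0 A0n0 _ _ [zeta1 reach ->]] h0; split=> //.
have F0 := normF_gt0 An0; have F00 := normF_gt0 A0n0.
rewrite cabsM cabs_real ?normF_ge0// ger_pMr//.
case: reach => [|s z w1 a ds z1 b *]; last exact: cabs_clip.
by rewrite cabsM cabs_real ?invr_ge0 ?normF_ge0// mulrC ler_pdivrMr// mul1r.
Qed.

(** In each of the three algorithms the initial value is an entry of the initial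
    matrix. *)
Lemma returned_bound m (A : 'M[C]_m.+1) zeta w :
  returned A zeta w -> A <> 0 /\ cabs zeta <= normF A.
Proof.
case=> [h|[eta [_ [j h]]]|[l0 [u [M [Q [_ h]]]]]]; apply: path_follow_bound h _.
- have := cabs_le_normF (delta_mx ord0 ord0 : 'M[C]_m.+1) ord0 ord0.
  by rewrite mxE eqxx.
- have := cabs_le_normF (diag_mx (\row_(k < m.+1) eta k)) j j.
  by rewrite !mxE eqxx mulr1n.
- set B := block_mx _ _ _ _; have := cabs_le_normF B ord0 ord0.
  have -> : B ord0 ord0 = l0; last by [].
  have -> : (ord0 : 'I_(1 + m)) = lshift m ord0 by apply: val_inj.
  by rewrite block_mxEul mxE eqxx mulr1n.
Qed.

End Returned.

(** * The refinement algorithm *)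

Definition setup_prog : prog :=
  Seq (SumTo 4 I0 3 (IMul rn rn) (CMul (CMem 0 ri) (CConj (CMem 0 ri))))
  (Seq (CSet 5 I0 (CCst 1)) (ISet 1 (IAdd rn (ICst 1)))).

(** With delta = 6 |A|_F tau the bound on the error of zeta, this is the square of
    2 delta <= eps |zeta|. *)
Definition stop_test : test :=
  TLeRe (CMul (CCst 144) (CMul (CMem 4 I0) (CMul (CMem 5 I0) (CMem 5 I0))))
        (CMul (CMul (CMem 3 I0) (CMem 3 I0))
              (CMul (CMem 2 I0) (CConj (CMem 2 I0)))).

Definition round_prog : prog :=
  Seq newton_prog (CSet 5 I0 (CDiv (CMul (CMem 5 I0) (CMem 5 I0)) (CCst 2))).

Definition refine_prog : prog :=
  Seq setup_prog (While (TNot stop_test) round_prog).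

Section Refinement.
Local Open Scope complex_scope.
Variable R : realType.
Local Notation C := R[i].

Definition newton_rate k : R := (1 / 2) ^+ (2 ^ k - 1).

Lemma newton_rate0 : newton_rate 0 = 1.
Proof. by []. Qed.

Lemma newton_rate_gt0 k : 0 < newton_rate k.
Proof. by rewrite exprn_gt0. Qed.

Lemma newton_rateS k : newton_rate k.+1 = newton_rate k * newton_rate k / 2.
Proof.
rewrite /newton_rate; have -> : (2 ^ k.+1 - 1 = 2 ^ k - 1 + (2 ^ k - 1) + 1)%N.
  have : (0 < 2 ^ k)%N by rewrite expn_gt0.
  by rewrite expnS; lia.
by rewrite !exprD expr1 mul1r.
Qed.

Lemma sum_flat (V : nmodType) m n (F : nat -> V) :
  \sum_(k < m * n) F k = \sum_(i < m) \sum_(j < n) F (i * n + j)%N.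
Proof.
elim: m => [|m IH]; first by rewrite !big_ord0.
by rewrite mulSnr big_split_ord /= IH big_ord_recr.
Qed.

Variable m : nat.
Local Notation n := m.+1.
Variables (A : 'M[C]_n) (zeta : C) (w : 'cV[C]_n) (l : C) (v : 'cV[C]_n) (eps : R).
Hypotheses (eps_gt0 : 0 < eps) (eps_lt1 : eps < 1 / 2).
Hypotheses (ret : returned A zeta w) (approx : approx_eigenpair A zeta w l v).

Let A0 : A <> 0 := proj1 (returned_bound ret).
Let F0 : 0 < normF A := normF_gt0 A0.

Definition refine_inv k (s : state R) : Prop :=
  exists2 z, newton_iter A k (zeta, w) = Some z &
  [/\ holds A z.1 z.2 s, cmem s 3 0 = eps%:C, cmem s 4 0 = (normF A ^+ 2)%:C
    & cmem s 5 0 = (newton_rate k)%:C].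

Lemma input_entry (i j : 'I_n) : cmem (input A zeta w eps) 0 (i * n + j) = A i j.
Proof.
have iN := ltn_ord i; have jN := ltn_ord j.
rewrite /= (_ : (i * n + j < n * n)%N); last by nia.
rewrite divnMDl// divn_small// addn0 modnMDl modn_small//.
by rewrite !inord_val.
Qed.

Lemma runs_setup :
  runs setup_prog (input A zeta w eps) (20 * n.+1 ^ 2)%N (refine_inv 0).
Proof.
set s := input _ _ _ _.
apply: (runs_then (runs_sum (N := (n * n)%N) (K := 0%N)
  (F := fun k => cmem s 0 k * (cmem s 0 k)^*) _ _)).
- by move=> s' ag; rewrite /= (proj1 ag).
- by move=> i s' _ ag xi; rewrite /= xi (proj2 ag).
- by rewrite /=; nia.
move=> s1 ag1 [h1 _].
have {}h1 : cmem s1 4 0 = (normF A ^+ 2)%:C.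
  rewrite h1 (sum_flat n n (fun k => cmem s 0 k * (cmem s 0 k)^*)) normF_sqr.
  rewrite rmorph_sum; apply: eq_bigr => i _; rewrite rmorph_sum.
  by apply: eq_bigr => j _; rewrite input_entry [RHS]cabs_sqr.
apply: (runs_then (runs_cset 5 I0 (CCst 1) s1)); first by rewrite /=; nia.
move=> s2 ag2 /= [h2 _].
apply: runs_weaken (runs_iset 1 _ s2) _ _; first by rewrite /=; nia.
move=> s3 ag3 /= h3; exists (zeta, w) => //; split.
- split=> /=.
  + by rewrite (proj1 ag3)// (proj1 ag2)// (proj1 ag1).
  + by rewrite h3 (proj1 ag2)// (proj1 ag1)//= addn1.
  + by move=> i j; rewrite (proj2 ag3)// (proj2 ag2)// (proj2 ag1)// input_entry.
  + move=> i; rewrite (proj2 ag3)// (proj2 ag2)// (proj2 ag1)//=.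
    by rewrite ltn_ord inord_val.
  + by rewrite (proj2 ag3)// (proj2 ag2)// (proj2 ag1).
- by rewrite (proj2 ag3)// (proj2 ag2)// (proj2 ag1).
- by rewrite (proj2 ag3)// (proj2 ag2)// h1.
- by rewrite (proj2 ag3)// h2 newton_rate0.
Qed.

Lemma iterate_newton k z : newton_iter A k (zeta, w) = Some z ->
  exists2 z1, newton A z = Some z1 & newton_iter A k.+1 (zeta, w) = Some z1.
Proof.
move=> E; case: approx => _ _ _ /(_ k.+1 isT) [z1 E1 _]; exists z1 => //.
by move: E1; rewrite /newton_iter iterS -/(newton_iter A k _) E.
Qed.

Lemma iterate_dist k z : newton_iter A k (zeta, w) = Some z ->
  dist_pair A z (l, v) <= 6 * newton_rate k.
Proof.
move=> E; case: (approx) => Av [v0 _] _ h.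
have D6 : dist_pair A (zeta, w) (l, v) <= 6.
  apply: dist_le6 => //; first exact: proj2 (returned_bound ret).
  exact: eigenvalue_le_normF Av v0.
case: k E => [[<-]|k E]; first by rewrite newton_rate0 mulr1.
have [z1] := h k.+1 isT; rewrite E => -[<-]; rewrite -/(newton_rate k.+1) => hz.
by apply: le_trans hz _; rewrite mulrC ler_wpM2r// ltW// newton_rate_gt0.
Qed.

Lemma runs_round k s : refine_inv k s ->
  runs round_prog s (280 * n.+1 ^ 3)%N (refine_inv k.+1).
Proof.
move=> [[l1 w1] E [hs h3 h4 h5]]; have [[l2 w2] N2 E2] := iterate_newton E.
apply: (runs_then (runs_newton hs N2)); first by nia.
move=> s1 ag1 hs1.
apply: runs_weaken (runs_cset 5 I0 _ s1) _ _; first by rewrite /=; nia.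
move=> s2 ag2 /= [g _]; exists (l2, w2) => //; split.
- exact: holds_agree ag2 isT isT hs1.
- by rewrite (proj2 ag2)// (proj2 ag1).
- by rewrite (proj2 ag2)// (proj2 ag1).
- rewrite g (proj2 ag1)// h5 newton_rateS !rmorphM fmorphV rmorph_nat.
  by [].
Qed.

Lemma stop_testE k s z : newton_iter A k (zeta, w) = Some z -> refine_inv k s ->
  teval s stop_test = (12 * (normF A * newton_rate k) <= eps * cabs z.1).
Proof.
move=> E [z1]; rewrite E => -[<-] [hs h3 h4 h5].
have -> : teval s stop_test =
   (complex.Re (144%:R * (cmem s 4 0 * (cmem s 5 0 * cmem s 5 0)))
    <= complex.Re (cmem s 3 0 * cmem s 3 0 * (cmem s 2 0 * (cmem s 2 0)^*))) by [].
rewrite h3 h4 h5 (holds_l hs) -cabs_sqr.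
have -> : (144%:R : C) = (144 : R)%:C by rewrite rmorph_nat.
have ReC (x : R) : complex.Re x%:C = x by [].
rewrite -!rmorphM !ReC -[RHS](@ler_pXn2r _ 2)//; last 2 first.
- by rewrite nnegrE !mulr_ge0 ?normF_ge0// ltW// newton_rate_gt0.
- by rewrite nnegrE mulr_ge0 ?cabs_ge0// ltW.
by congr (_ <= _); ring.
Qed.

(** With delta = 6 |A|_F tau, the test reads 2 delta <= eps |zeta'|; since
    |zeta'| <= |lambda| + delta and eps <= 1, it gives delta <= eps |lambda|. As
    |lambda| <= |A|_F, the angle 6 tau = delta / |A|_F is then at most eps. *)
Lemma stop_accurate k z : newton_iter A k (zeta, w) = Some z ->
  12 * (normF A * newton_rate k) <= eps * cabs z.1 ->
  [/\ z.2 <> 0, dP z.2 v <= eps & cabs (z.1 - l) <= eps * cabs l].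
Proof.
move=> E test; have hd := iterate_dist E; case: (approx) => Av [v0 _] _ _.
have lF := eigenvalue_le_normF Av v0.
have h1 : cabs (z.1 - l) <= 6 * (normF A * newton_rate k).
  apply: le_trans (dist_le_fst z (l, v) A0) _.
  by rewrite mulrCA ler_wpM2l// ltW.
have h2 : cabs z.1 <= cabs l + cabs (z.1 - l).
  by rewrite -[X in cabs X <= _](subrK l) addrC cabsD.
have {test h2} hl : 6 * (normF A * newton_rate k) <= eps * cabs l.
  have d0 : 0 <= normF A * newton_rate k.
    by rewrite mulr_ge0// ltW// newton_rate_gt0.
  have h3 : eps * cabs z.1 <= eps * (cabs l + 6 * (normF A * newton_rate k)).
    by rewrite ler_pM2l//; apply: le_trans h2 _; rewrite lerD2l.
  have h4 : eps * (normF A * newton_rate k) <= normF A * newton_rate k.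
    rewrite ger_pMl// ?mulr_gt0 ?newton_rate_gt0//.
    by apply: ltW; apply: lt_trans eps_lt1 _; lra.
  lra.
have [[l2 w2] /newton_defined [z20 _] _] : exists2 z1, newton A (z.1, z.2) = Some z1
    & newton_iter A k.+1 (zeta, w) = Some z1.
  by case: z {h1} E hd => z1 z2 /iterate_newton.
split=> //; last exact: le_trans h1 hl.
apply: le_trans (dist_le_snd A z (l, v)) _; apply: le_trans hd _.
rewrite -(@ler_pM2l _ (normF A))//; rewrite mulrCA; apply: le_trans hl _.
by rewrite mulrC ler_wpM2r// ltW.
Qed.

Lemma refine_correct c s : exec refine_prog (input A zeta w eps) c s ->
  [/\ out_vec m s <> 0, dP (out_vec m s) v <= eps
    & cabs (out_zeta s - l) <= eps * cabs l].
Proof.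
move=> /exec_seq_inv[c1 [s1 [c2 [h1 h2]]]].
have [d [s2 [g1 _ g2]]] := runs_setup; have [_ E1] := exec_det g1 h1; subst s2.
have [||[k hk] hstop] := while_exit (I := fun s => exists k, refine_inv k s) h2.
- by exists 0%N.
- move=> t1 e t2 [i hi] _ ht; exists i.+1.
  by have [d' [t3 [f1 _ f2]]] := runs_round hi; have [_ <-] := exec_det f1 ht.
move: (hk) => [z E [hs _ _ _]].
have wE : out_vec m s = z.2.
  by apply/colP => i; rewrite mxE (holds_w hs).
rewrite wE /out_zeta (holds_l hs).
apply: (stop_accurate E); rewrite -(stop_testE E hk).
by move: hstop; rewrite /= negbK.
Qed.

(** If 3 delta <= eps |lambda| then, as |zeta'| >= |lambda| - delta and eps <= 1,
    eps |zeta'| >= eps |lambda| - delta >= 2 delta and the test succeeds. *)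
Lemma refine_cost k : 18 * (normF A * newton_rate k) <= eps * cabs l ->
  runs refine_prog (input A zeta w eps) (400 * n.+1 ^ 3 * k.+1)%N (fun=> True).
Proof.
move=> hk; apply: (runs_then runs_setup); first by nia.
move=> s _ h0.
apply: runs_weaken (runs_while (k := k) (c := (280 * n.+1 ^ 3)%N) (I := refine_inv) _ _
  (j := k) (i := 0%N) _ h0) _ _ => //.
- by move=> i s1 hi _; exact: runs_round.
- move=> s1 h1; case: (h1) => z E _; rewrite [teval _ _]/= negbK.
  rewrite (_ : (_ <= _) = teval s1 stop_test)// (stop_testE E h1).
  have hd := iterate_dist E.
  have g1 : cabs (z.1 - l) <= 6 * (normF A * newton_rate k).
    apply: le_trans (dist_le_fst z (l, v) A0) _.
    by rewrite mulrCA ler_wpM2l// ltW.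
  have g2 : cabs l <= cabs z.1 + cabs (z.1 - l).
    by rewrite -(cabsN (_ - _)) opprB -[X in cabs X <= _](subrK z.1) addrC cabsD.
  have g3 : eps * cabs l <= eps * (cabs z.1 + 6 * (normF A * newton_rate k)).
    by rewrite ler_pM2l//; apply: le_trans g2 _; rewrite lerD2l.
  have h4 : eps * (normF A * newton_rate k) <= normF A * newton_rate k.
    rewrite ger_pMl// ?mulr_gt0 ?newton_rate_gt0//.
    by apply: ltW; apply: lt_trans eps_lt1 _; lra.
  lra.
- by rewrite [tcost _]/=; nia.
Qed.

End Refinement.

(** * Tails and anticoncentration of the normal law *)

Section Normal.
Local Open Scope classical_set_scope.
Variable R : realType.
Local Notation sigma := (Num.sqrt (1 / 2) : R).
Local Notation mu := (@lebesgue_measure R).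

Lemma measurable_gt_norm (t : R) : measurable [set x : R | t < `|x|].
Proof.
rewrite (_ : [set _ | _] = (fun x : R => `|x|) @^-1` `]t, +oo[); last first.
  by apply/seteqP; split => x /=; rewrite in_itv /= andbT.
by rewrite -[X in measurable X]setTI; apply: normr_measurable.
Qed.

Lemma sigma_neq0 : sigma != 0.
Proof. by rewrite sqrtr_eq0 -ltNge. Qed.

Lemma normal_pdf_le1 (x : R) : normal_pdf 0 sigma x <= 1.
Proof.
apply: le_trans (normal_pdf_ub 0 x sigma_neq0) _.
rewrite /normal_peak invf_le1.
  rewrite -[leLHS]sqrtr1 ler_wsqrtr// sqr_sqrtr//.
  by have := @pi_ge2 R; lra.
rewrite sqrtr_gt0 sqr_sqrtr//.
by have := @pi_ge2 R; lra.
Qed.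

Lemma normal_prob_itv (a b : R) : a <= b ->
  (normal_prob 0 sigma `[a, b] <= (b - a)%:E)%E.
Proof.
move=> ab; rewrite /normal_prob.
apply: (@le_trans _ _ (\int[mu]_(x in `[a, b]) (1%:E))%E).
  apply: ge0_le_integral => //=.
  - by move=> x _; rewrite lee_fin normal_pdf_ge0.
  - apply/measurable_EFinP; apply: measurable_funTS; exact: measurable_normal_pdf.
  - by move=> x _; rewrite lee_fin normal_pdf_le1.
rewrite integral_cst//= mul1e lebesgue_measure_itv/= lte_fin.
by case: ltP => //; rewrite lee_fin subr_ge0.
Qed.

(** exp(-x^2) <= exp(-t^2/2) exp(-x^2/2) when |x| >= t, and the last factor is,
    up to a constant, the density of another normal law. *)
Lemma normal_prob_tail (t : R) : 0 < t ->
  (normal_prob 0 sigma [set x : R | (t < `|x|)%R] <= (4 / t)%:E)%E.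
Proof.
move=> t0; have mD := measurable_gt_norm t.
have s2 : sigma ^+ 2 = 1 / 2 by rewrite sqr_sqrtr.
have peak : normal_peak sigma <= 2 * normal_peak (1 : R).
  rewrite /normal_peak s2 expr1n mul1r.
  have pi0 := @pi_gt0 R; set a := Num.sqrt _; set b := Num.sqrt _.
  have a0 : 0 < a by rewrite sqrtr_gt0; lra.
  have b0 : 0 < b by rewrite sqrtr_gt0; lra.
  have a2 : a ^+ 2 = pi by rewrite sqr_sqrtr; lra.
  have b2 : b ^+ 2 = 2 * pi by rewrite sqr_sqrtr; lra.
  have ba : b <= 2 * a by rewrite -(@ler_pXn2r _ 2)// ?nnegrE ?exprMn ?a2 ?b2; lra.
  by rewrite ler_pdivlMr// mulrC ler_pdivrMr.
have dens x : t < `|x| -> normal_pdf 0 sigma x <= 4 / t * normal_pdf 0 1 x.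
  have pdfE (s y : R) : s != 0 ->
      normal_pdf 0 s y = normal_peak s * expR (- y ^+ 2 / (s ^+ 2 *+ 2)).
    by move=> s0; rewrite /normal_pdf (negbTE s0) /normal_fun subr0.
  move=> tx; rewrite !pdfE ?sigma_neq0 ?oner_neq0// s2.
  have -> : - x ^+ 2 / (1 / 2 *+ 2) = - x ^+ 2 / 2 + - x ^+ 2 / (1 ^+ 2 *+ 2) :> R.
    by field.
  rewrite expRD !mulrA; apply: ler_pM; rewrite ?expR_ge0//.
    by rewrite mulr_ge0 ?normal_peak_ge0 ?expR_ge0.
  have e : expR (- x ^+ 2 / 2) <= 2 / t.
    rewrite mulNr expRN -[leRHS]invrK ler_pV2 ?inE ?unitf_gt0 ?expR_gt0 ?invr_gt0 ?divr_gt0//.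
    rewrite invf_div; apply: le_trans (expR_ge1Dx _).
    have : t ^+ 2 <= x ^+ 2 by rewrite -(real_normK (num_real x)) ler_pXn2r// ?nnegrE ltW.
    nra.
  have p1 : 0 <= normal_peak (1 : R) by exact: normal_peak_ge0.
  have e0 := expR_ge0 (- x ^+ 2 / 2).
  apply: (@le_trans _ _ (2 * normal_peak (1 : R) * (2 / t))).
    by apply: ler_pM => //; exact: normal_peak_ge0.
  by rewrite le_eqVlt; apply/orP; left; apply/eqP; field; rewrite gt_eqF.
rewrite /normal_prob.
apply: (@le_trans _ _ (\int[mu]_(x in [set x : R | (t < `|x|)%R]) ((4 / t)%:E * (normal_pdf 0 1 x)%:E))%E).
  apply: ge0_le_integral => //=.
  - by move=> x _; rewrite lee_fin normal_pdf_ge0.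
  - apply/measurable_EFinP; apply: measurable_funTS; exact: measurable_normal_pdf.
  - apply/measurable_EFinP; apply: measurable_funTS; apply: measurable_funM => //.
    exact: measurable_normal_pdf.
rewrite ge0_integralZl_EFin//=; last 3 first.
- by move=> x _; rewrite lee_fin normal_pdf_ge0.
- apply/measurable_EFinP; apply: measurable_funTS; exact: measurable_normal_pdf.
- by rewrite divr_ge0 ?ltW.
rewrite -[leRHS]mule1; apply: lee_wpmul2l; first by rewrite lee_fin divr_ge0// ltW.
exact: (probability_le1 (normal_prob 0 1 : probability _ R) mD).
Qed.

End Normal.

Section SmallBall.
Local Open Scope classical_set_scope.
Local Open Scope ereal_scope.
Context d (T : measurableType d) (R : realType) (P : probability T R).

(** Given Y, the event asks X to fall in an interval of length 2 h, and the density
    of X is at most 1. *)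
Lemma small_ball (X Y : T -> R) (h : R) :
  measurable_fun setT X -> measurable_fun setT Y ->
  (forall I J, measurable I -> measurable J ->
    P (Y @^-1` I `&` X @^-1` J) = P (Y @^-1` I) * P (X @^-1` J)) ->
  (forall J, measurable J -> P (X @^-1` J) = normal_prob 0 (Num.sqrt (1 / 2)) J) ->
  (0 < h)%R ->
  P [set t | (`|X t + Y t| < h)%R] <= (2 * h)%:E.
Proof.
move=> mX mY ind law h0.
pose X' : {mfun T >-> R} := HB.pack X (isMeasurableFun.Build _ _ _ _ X mX).
pose Y' : {mfun T >-> R} := HB.pack Y (isMeasurableFun.Build _ _ _ _ Y mY).
have mZ : measurable_fun setT (fun t => (Y t, X t)) by exact: measurable_fun_pair.
pose Z' : {mfun T >-> (R * R)%type} := HB.pack (fun t => (Y t, X t))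
  (isMeasurableFun.Build _ _ _ _ (fun t => (Y t, X t)) mZ).
pose S : set (R * R) := [set z | (`|z.2 + z.1| < h)%R].
have mS : measurable S.
  rewrite (_ : S = (fun z : R * R => `|z.2 + z.1|%R) @^-1` `]-oo, h[); last first.
    by apply/seteqP; split => z /=; rewrite in_itv.
  rewrite -[X in measurable X]setTI.
  have : measurable_fun setT (fun z : R * R => `|z.2 + z.1|%R).
    by apply: measurableT_comp => //; apply: measurable_funD.
  by apply.
have -> : P [set t | (`|X t + Y t| < h)%R] = distribution P Z' S by [].
rewrite -(product_measure_unique (m1 := distribution P Y') (m2 := distribution P X')); last 2 first.
- by move=> I J mI mJ; rewrite /= /distribution /pushforward -ind.
- by [].
rewrite /product_measure1 /=.
apply: (@le_trans _ _ (\int[distribution P Y']_y (2 * h)%:E)).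
  apply: ge0_le_integral => //=.
  - exact: measurable_fun_xsection.
  - move=> y _; rewrite /distribution /pushforward law; last exact: measurable_xsection.
    have sub : xsection S y `<=` `[(- h - y)%R, (h - y)%R].
      by move=> x; rewrite /xsection /= inE /S /= in_itv /= ltr_norml; lra.
    apply: (@le_trans _ _ (normal_prob 0 (Num.sqrt (1 / 2)) `[(- h - y)%R, (h - y)%R])).
      by apply: le_measure => //; rewrite inE//; exact: measurable_xsection.
    apply: le_trans (normal_prob_itv _) _; first by lra.
    by rewrite lee_fin; lra.
rewrite integral_cst//= -[leRHS]mule1; apply: lee_wpmul2l; first by rewrite lee_fin; lra.
exact: (probability_le1 (distribution P Y' : probability _ R) measurableT).
Qed.

End SmallBall.

(** * Independence of an entry from the others *)

Section ComplexMeasurable.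
Local Open Scope classical_set_scope.
Local Open Scope complex_scope.
Context d (T : measurableType d) (R : realType).
Local Notation C := R[i].

Definition cmeasurable (f : T -> C) :=
  measurable_fun setT (fun t => complex.Re (f t)) /\
  measurable_fun setT (fun t => complex.Im (f t)).

Lemma cmeasurable_cst (c : C) : cmeasurable (fun=> c).
Proof. by split; exact: measurable_cst. Qed.

Lemma cmeasurableD (f g : T -> C) :
  cmeasurable f -> cmeasurable g -> cmeasurable (fun t => f t + g t).
Proof.
move=> [f1 f2] [g1 g2]; split.
  rewrite (_ : (fun _ => _) = (fun t => complex.Re (f t) + complex.Re (g t))).
    exact: measurable_funD.
  by apply/funext => t; case: (f t) => ? ?; case: (g t).
rewrite (_ : (fun _ => _) = (fun t => complex.Im (f t) + complex.Im (g t))).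
  exact: measurable_funD.
by apply/funext => t; case: (f t) => ? ?; case: (g t).
Qed.

Lemma cmeasurableM (f g : T -> C) :
  cmeasurable f -> cmeasurable g -> cmeasurable (fun t => f t * g t).
Proof.
move=> [f1 f2] [g1 g2]; split.
  rewrite (_ : (fun _ => _) = (fun t => complex.Re (f t) * complex.Re (g t)
      - complex.Im (f t) * complex.Im (g t))).
    by apply: measurable_funB; exact: measurable_funM.
  by apply/funext => t; case: (f t) => ? ?; case: (g t).
rewrite (_ : (fun _ => _) = (fun t => complex.Re (f t) * complex.Im (g t)
    + complex.Im (f t) * complex.Re (g t))).
  by apply: measurable_funD; exact: measurable_funM.
by apply/funext => t; case: (f t) => ? ?; case: (g t).
Qed.

Lemma cmeasurableV (f : T -> C) : cmeasurable f -> cmeasurable (fun t => (f t)^-1).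
Proof.
move=> [f1 f2].
pose N t := complex.Re (f t) ^+ 2 + complex.Im (f t) ^+ 2.
(* the real inverse is not continuous at 0, but on nonnegative reals it is the
   power -1, with the same value at 0 *)
have mN : measurable_fun setT (fun t => (N t)^-1).
  rewrite (_ : (fun _ => _) = (fun t => N t `^ (-1))); last first.
    by apply/funext => t; rewrite powR_inv1// addr_ge0// sqr_ge0.
  have := @measurable_powR R (-1) => /measurableT_comp; apply.
  by apply: measurable_funD; exact: measurable_funX.
split.
  rewrite (_ : (fun _ => _) = (fun t => complex.Re (f t) * (N t)^-1)).
    exact: measurable_funM.
  by apply/funext => t; rewrite /N; case: (f t).
rewrite (_ : (fun _ => _) = (fun t => - complex.Im (f t) * (N t)^-1)).
  by apply: measurable_funM => //; exact: measurableT_comp.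
by apply/funext => t; rewrite /N mulNr; case: (f t).
Qed.

Lemma cmeasurable_sum (I : Type) (r : seq I) (p : pred I) (F : I -> T -> C) :
  (forall i, p i -> cmeasurable (F i)) ->
  cmeasurable (fun t => \sum_(i <- r | p i) F i t).
Proof.
move=> h; elim: r => [|i r IH].
  rewrite (_ : (fun _ => _) = fun=> 0); first exact: cmeasurable_cst.
  by apply/funext => t; rewrite big_nil.
have [pi|npi] := boolP (p i); last first.
  by rewrite (_ : (fun _ => _) = (fun t => \sum_(i <- r | p i) F i t))//;
    apply/funext => t; rewrite big_cons (negbTE npi).
rewrite (_ : (fun _ => _) = (fun t => F i t + \sum_(i <- r | p i) F i t)).
  by apply: cmeasurableD => //; exact: h.
by apply/funext => t; rewrite big_cons pi.
Qed.

Lemma cmeasurable_prod (I : Type) (r : seq I) (F : I -> T -> C) :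
  (forall i, cmeasurable (F i)) ->
  cmeasurable (fun t => \prod_(i <- r) F i t).
Proof.
move=> h; elim: r => [|i r IH].
  rewrite (_ : (fun _ => _) = fun=> 1); first exact: cmeasurable_cst.
  by apply/funext => t; rewrite big_nil.
rewrite (_ : (fun _ => _) = (fun t => F i t * \prod_(i <- r) F i t)).
  exact: cmeasurableM.
by apply/funext => t; rewrite big_cons.
Qed.

Lemma cmeasurable_det n (M : T -> 'M[C]_n) :
  (forall i j, cmeasurable (fun t => M t i j)) -> cmeasurable (fun t => \det (M t)).
Proof.
move=> h; rewrite /determinant; apply: cmeasurable_sum => s _.
by apply: cmeasurableM; [exact: cmeasurable_cst|exact: cmeasurable_prod].
Qed.

Lemma cmeasurable_cofactor n (M : T -> 'M[C]_n) i j :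
  (forall k l, k != i -> l != j -> cmeasurable (fun t => M t k l)) ->
  cmeasurable (fun t => cofactor (M t) i j).
Proof.
move=> h; rewrite /cofactor; apply: cmeasurableM; first exact: cmeasurable_cst.
apply: cmeasurable_det => k l.
rewrite (_ : (fun _ => _) = (fun t => M t (lift i k) (lift j l))).
  by apply: h; rewrite eq_sym neq_lift.
by apply/funext => t; rewrite !mxE.
Qed.

End ComplexMeasurable.

Section GaussianEntries.
Local Open Scope classical_set_scope.
Local Open Scope ereal_scope.
Context d (T : measurableType d) (R : realType) (P : probability T R).
Local Notation C := R[i].
Variables (n : nat) (A : T -> 'M[C]_n).
Hypothesis gA : gaussian_matrix P A.
Local Notation idx := ('I_n * 'I_n * bool)%type.
Local Notation X := (entry_part A).

Let mX k : measurable_fun setT (X k). Proof. by case: gA. Qed.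

(** A pi-system generating the same sigma-algebra as all the real and imaginary parts
    of entries but the one of index k0. *)
Definition others (k0 : idx) : set (set T) :=
  [set D | exists B : idx -> set R, [/\ forall k, measurable (B k), B k0 = setT &
    D = \bigcap_k (X k @^-1` B k)]].

Lemma others_measurable k0 : others k0 `<=` measurable.
Proof.
move=> D [B [mB _ ->]]; apply: fin_bigcap_measurable => [|k _].
  exact: finite_finset.
by rewrite -[X in measurable X]setTI; exact: mX.
Qed.

Lemma others_setI k0 : setI_closed (others k0).
Proof.
move=> _ _ [B1 [m1 b1 ->]] [B2 [m2 b2 ->]].
exists (fun k => B1 k `&` B2 k); split.
- by move=> k; exact: measurableI.
- by rewrite b1 b2 setTI.
- by rewrite -bigcapI.
Qed.

Lemma others_preimage k0 k J : k != k0 -> measurable J -> others k0 (X k @^-1` J).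
Proof.
move=> kk0 mJ; exists (fun l => if l == k then J else setT); split.
- by move=> l; case: eqP.
- by rewrite eq_sym (negbTE kk0).
- apply/seteqP; split=> [t h l _ /=|t /(_ k I)].
    by case: eqP => // ->.
  by rewrite /= eqxx.
Qed.

(** The product rule holds on the pi-system; both sides are finite measures in D,
    so it extends to the generated sigma-algebra. *)
Lemma indep_others k0 D J : <<s others k0 >> D -> measurable J ->
  P (D `&` X k0 @^-1` J) = P D * P (X k0 @^-1` J).
Proof.
move=> sD mJ.
have mE : measurable (X k0 @^-1` J) by rewrite -[X in measurable X]setTI; exact: mX.
set E := X k0 @^-1` J in mE *.
have PE : P E = (fine (P E))%:E by rewrite fineK// fin_num_measure.
have E0 : (0 <= fine (P E))%R by rewrite fine_ge0.
pose m1 := mrestr P mE.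
pose m2 := mscale (NngNum E0) P.
have m2E F : m2 F = P E * P F by rewrite PE.
rewrite muleC; transitivity (m1 D) => //; transitivity (m2 D); last first.
  by rewrite m2E.
apply: (@g_sigma_algebra_measure_unique _ _ _ (others k0) (@others_measurable k0)
  (fun=> setT)) => //.
- move=> _; exists (fun=> setT); split=> //.
  by apply/seteqP; split.
- by apply/seteqP; split=> // t _; exists 0%N.
- exact: others_setI.
- move=> _ [B [mB b0 ->]]; set F := \bigcap_k _.
  suff h : P (F `&` E) = P E * P F by exact: etrans h (esym (m2E F)).
  rewrite {}/F.
  have [_ _ indep] := gA.
  pose B' k := if k == k0 then J else B k.
  have mB' k : measurable (B' k) by rewrite /B'; case: eqP.
  have -> : \bigcap_k (X k @^-1` B k) `&` E = \bigcap_k (X k @^-1` B' k).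
    apply/seteqP; split=> [t [h1 h2] k _|t h].
      by rewrite /= /B'; case: eqP => [->//|_]; exact: h1.
    split=> [k _|]; last by have := h k0 I; rewrite /= /B' eqxx.
    by have := h k I; rewrite /= /B'; case: eqP => // -> _; rewrite b0.
  rewrite (indep B mB) (indep B' mB') (bigD1 k0)//= [in RHS](bigD1 k0)//= b0 preimage_setT.
  rewrite probability_setT mul1e {1}/B' eqxx; congr (_ * _).
  by apply: eq_bigr => k /negbTE kk0; rewrite /B' kk0.
- move=> _; suff : P (setT `&` E) < +oo by [].
  rewrite setTI.
  by apply: le_lt_trans (probability_le1 P mE) _; rewrite ltry.
Qed.

Definition others_space k0 := g_sigma_algebraType (others k0).

Lemma cmeasurable_entry k0 i j : (i, j) != k0.1 ->
  @cmeasurable _ (others_space k0) R (fun t => A t i j).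
Proof.
move=> ij; split=> _ J mJ; rewrite setTI; apply: sub_sigma_algebra.
- have := @others_preimage k0 (i, j, false) J; apply => //.
  by apply: contra ij => /eqP <-.
- have := @others_preimage k0 (i, j, true) J; apply => //.
  by apply: contra ij => /eqP <-.
Qed.

Lemma others_small_ball i j (Y : T -> R) (h : R) :
  measurable_fun setT (Y : others_space (i, j, false) -> R) -> (0 < h)%R ->
  measurable [set t | (`|complex.Re (A t i j) + Y t| < h)%R] /\
  P [set t | (`|complex.Re (A t i j) + Y t| < h)%R] <= (2 * h)%:E.
Proof.
set k0 := (i, j, false) => mY h0.
have sY J : measurable J -> <<s others k0 >> (Y @^-1` J).
  by move=> mJ; rewrite -[Y @^-1` J]setTI; exact: mY.
have mY' : measurable_fun setT Y.
  move=> _ J mJ; rewrite setTI; have := sY _ mJ; apply: smallest_sub.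
    exact: sigma_algebra_measurable.
  exact: others_measurable.
split.
  rewrite -[X in measurable X]setTI.
  rewrite (_ : [set _ | _] = (fun t => `|X k0 t + Y t|%R) @^-1` `]-oo, h[); last first.
    by apply/seteqP; split => z /=; rewrite in_itv.
  have : measurable_fun setT (fun t => `|X k0 t + Y t|%R).
    by apply: measurableT_comp => //; apply: measurable_funD.
  by apply.
apply: (small_ball (X := X k0)) => //.
- by move=> I J mI mJ; apply: indep_others => //; exact: sY.
- by case: gA => _ law _ J mJ; exact: law.
Qed.

End GaussianEntries.

(** * Condition of a Gaussian matrix *)

Section Small.
Local Open Scope classical_set_scope.
Context d (T : measurableType d) (R : realType) (P : probability T R).

(** A bound on the outer probability: S need not be measurable. *)
Definition small (S : set T) (b : R) : Prop :=
  exists B, [/\ measurable B, S `<=` B & (P B <= b%:E)%E].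

Lemma small_set0 b : 0 <= b -> small set0 b.
Proof. by move=> b0; exists set0; split=> //; rewrite measure0 lee_fin. Qed.

Lemma smallS S S' b b' : S `<=` S' -> b' <= b -> small S' b' -> small S b.
Proof.
move=> SS bb [B [mB SB PB]]; exists B; split=> //; first exact: subset_trans SB.
by apply: le_trans PB _; rewrite lee_fin.
Qed.

Lemma smallU S S' b b' : small S b -> small S' b' -> small (S `|` S') (b + b').
Proof.
move=> [B [mB SB PB]] [B' [mB' SB' PB']]; exists (B `|` B'); split.
- exact: measurableU.
- exact: setUSS.
- by apply: le_trans (measureU2 _ _ _) _ => //; rewrite EFinD leeD.
Qed.

Lemma small_exists (I : finType) (S : I -> set T) b :
  (forall i, small (S i) b) -> small [set t | exists i, S i t] (#|I|%:R * b).
Proof.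
move=> h; suff H (r : seq I) : small [set t | exists2 i, i \in r & S i t] ((size r)%:R * b).
  rewrite cardE; apply: smallS (lexx _) (H _) => t [i Si] /=.
  by exists i => //; rewrite mem_enum.
elim: r => [|i r IH].
  by rewrite mul0r; apply: smallS (lexx _) (small_set0 (lexx _)) => t [].
rewrite /= -add1n natrD mulrDl mul1r; apply: smallS (lexx _) (smallU (h i) IH).
by move=> t [j]; rewrite inE => /predU1P[->|jr] Sj; [left|right; exists j].
Qed.

End Small.

Section Minors.
Local Open Scope classical_set_scope.
Context d (T : measurableType d) (R : realType) (P : probability T R).
Local Notation C := R[i].
Variables (n : nat) (A : T -> 'M[C]_n).
Hypothesis gA : gaussian_matrix P A.

Section OneMinor.
Variables (r : nat) (f g : 'I_r -> 'I_n).
Hypotheses (f_inj : injective f) (g_inj : injective g).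
Local Notation M t := (mxsub f g (A t)).

Definition rest_ratio (i j : 'I_r) (t : T) : R :=
  complex.Re ((\sum_(k | k != j) M t i k * cofactor (M t) i k) / cofactor (M t) i j).

Definition near_ratio i j (h : R) : set T :=
  [set t | `|complex.Re (A t (f i) (g j)) + rest_ratio i j t| < h].

Lemma det_split t i j : \det (M t) = A t (f i) (g j) * cofactor (M t) i j
   + \sum_(k | k != j) M t i k * cofactor (M t) i k.
Proof. by rewrite (expand_det_row _ i) (bigD1 j)//= mxE. Qed.

(** By the expansion along row i, the determinant is the cofactor times the sum
    of the entry (i, j) and a quantity that is independent of this entry; such a
    sum is rarely small, whatever this quantity. *)
Lemma near_ratio_small i j h : 0 < h -> small P (near_ratio i j h) (2 * h).
Proof.
move=> h0; exists (near_ratio i j h).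
suff mY : measurable_fun setT
    (rest_ratio i j : others_space A (f i, g j, false) -> R).
  by have [] := others_small_ball gA mY h0; split.
have ment k l : (k != i) || (l != j) ->
    @cmeasurable _ (others_space A (f i, g j, false)) R (fun t => M t k l).
  move=> kl; rewrite (_ : (fun _ => _) = (fun t => A t (f k) (g l))).
    apply: cmeasurable_entry => /=; apply: contraL kl => /eqP[/f_inj-> /g_inj->].
    by rewrite !eqxx.
  by apply/funext => t; rewrite mxE.
have mcof l : @cmeasurable _ (others_space A (f i, g j, false)) R
    (fun t => cofactor (M t) i l).
  by apply: cmeasurable_cofactor => k l' ki _; apply: ment; rewrite ki.
suff [] : @cmeasurable _ (others_space A (f i, g j, false)) R
  (fun t => (\sum_(k | k != j) M t i k * cofactor (M t) i k) / cofactor (M t) i j) by [].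
apply: cmeasurableM; last exact: cmeasurableV.
apply: cmeasurable_sum => k kj; apply: cmeasurableM => //.
by apply: ment; rewrite kj orbT.
Qed.

Lemma cofactor_le_det i j h t : 0 < h -> ~ near_ratio i j h t ->
  h * cabs (cofactor (M t) i j) <= cabs (\det (M t)).
Proof.
move=> h0 /negP; rewrite -leNgt => hle.
have [->|c0] := eqVneq (cofactor (M t) i j) 0; first by rewrite cabs0 mulr0 cabs_ge0.
set W := \sum_(k | k != j) M t i k * cofactor (M t) i k.
have -> : \det (M t) = (A t (f i) (g j) + W / cofactor (M t) i j) * cofactor (M t) i j.
  by rewrite (det_split t i j) mulrDl divfK.
rewrite cabsM ler_wpM2r ?cabs_ge0//; apply: le_trans hle _.
apply: le_trans (Re_le_cabs _); rewrite /rest_ratio -/W.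
by case: (A t _ _) => a b; case: (W / _) => a' b'.
Qed.

End OneMinor.

(** Induction on the order: off the event that a minor of smaller order vanishes,
    the cofactor at (0, 0) is nonzero, and the determinant can vanish only if the
    sum of [near_ratio] is 0, hence less than any h. *)
Lemma minor_neq0_as r (f g : 'I_r -> 'I_n) : injective f -> injective g ->
  forall b, 0 < b -> small P [set t | \det (mxsub f g (A t)) = 0] b.
Proof.
elim: r f g => [|r IH] f g f_inj g_inj b b0.
  apply: smallS (lexx _) (small_set0 P (ltW b0)) => t /= /eqP.
  by rewrite det_mx00 oner_eq0.
have b2 : 0 < b / 2 by lra.
have b4 : 0 < b / 4 by lra.
have lf : injective (f \o lift ord0) by apply: inj_comp => //; exact: lift_inj.
have lg : injective (g \o lift ord0) by apply: inj_comp => //; exact: lift_inj.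
apply: smallS (smallU (IH _ _ lf lg _ b2) (near_ratio_small f_inj g_inj ord0 ord0 b4)).
  move=> t /= det0.
  have [|near] := pselect (near_ratio f g ord0 ord0 (b / 4) t); first by right.
  left; have := cofactor_le_det b4 near; rewrite det0 cabs0 => le0.
  have : cabs (cofactor (mxsub f g (A t)) ord0 ord0) = 0.
    apply/eqP; rewrite eq_le cabs_ge0 andbT -(@ler_pM2l _ (b / 4))//.
    by rewrite mulr0.
  move=> /cabs_eq0; rewrite /cofactor addn0 expr0 mul1r => <-.
  by congr (\det _); apply/matrixP => i j; rewrite !mxE.
lra.
Qed.

End Minors.

Section WellConditioned.
Local Open Scope classical_set_scope.
Variable R : realType.
Local Notation C := R[i].

(** Bounds on the entries and on the inverse of M at the same scale t; the bound on
    the inverse is stated without division. *)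
Definition well_conditioned n (t : R) (M : 'M[C]_n) : Prop :=
  [/\ forall i j, `|complex.Re (M i j)| <= t /\ `|complex.Im (M i j)| <= t,
      \det M <> 0 &
      forall i j, cabs (cofactor M i j) <= t * cabs (\det M)].

Lemma gaussian_well_conditioned d (T : measurableType d) (P : probability T R)
    m (A : T -> 'M[C]_m.+1) t :
  gaussian_matrix P A -> 0 < t ->
  small P [set x | ~ well_conditioned t (A x)] (11 * m.+1%:R ^+ 2 / t).
Proof.
move=> gA t0.
have tail (k : 'I_m.+1 * 'I_m.+1 * bool) :
    small P [set x | t < `|entry_part A k x|] (4 / t).
  have mD := measurable_gt_norm t.
  case: gA => mX law _.
  exists (entry_part A k @^-1` [set x : R | t < `|x|]); split=> //.
    by rewrite -[X in measurable X]setTI; exact: mX.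
  by rewrite law//; exact: normal_prob_tail.
have tV : 0 < t^-1 by rewrite invr_gt0.
have cof (ij : 'I_m.+1 * 'I_m.+1) :=
  near_ratio_small gA (@inj_id _) (@inj_id _) ij.1 ij.2 tV.
have det0 := minor_neq0_as gA (@inj_id 'I_m.+1) (@inj_id 'I_m.+1) tV.
have mxid (M : 'M[C]_m.+1) : mxsub id id M = M by apply/matrixP => i j; rewrite mxE.
apply: smallS (smallU (small_exists tail) (smallU (small_exists cof) det0)).
  move=> x /= nwell; apply: contra_notP nwell => /not_orP[h1 /not_orP[h2 h3]].
  split.
  - move=> i j; split; rewrite leNgt; apply/negP => h; apply: h1.
      by exists (i, j, false).
    by exists (i, j, true).
  - by move=> h; apply: h3; rewrite mxid.
  - move=> i j; have near : ~ near_ratio A id id i j t^-1 x.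
      by move=> h; apply: h2; exists (i, j).
    have := cofactor_le_det tV near; rewrite mxid.
    by rewrite ler_pdivrMl.
rewrite !card_prod !card_ord card_bool !natrM.
have : (1 : R) <= m.+1%:R by rewrite ler1n.
rewrite -natrM natrM -!mulrA.
set k : R := m.+1%:R => k1.
have -> : k * (k * (2 * (4 * t^-1))) + (k * (k * (2 * t^-1)) + t^-1)
   = (10 * k ^+ 2 + 1) * t^-1 by ring.
have -> : 11 * (k * (k / t)) = 11 * k ^+ 2 * t^-1 by ring.
rewrite ler_wpM2r ?invr_ge0 ?(ltW t0)//.
nra.
Qed.

Variables (m : nat) (M : 'M[C]_m.+1) (t : R).
Hypothesis wellM : well_conditioned t M.

Lemma well_conditioned_ge0 : 0 <= t.
Proof. by case: wellM => /(_ ord0 ord0)[h _] _ _; apply: le_trans h. Qed.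

Lemma well_conditioned_normF : normF M <= 2 * m.+1%:R * t.
Proof.
have t0 := well_conditioned_ge0.
rewrite -(@ler_pXn2r _ 2)// ?nnegrE ?normF_ge0 ?mulr_ge0//.
rewrite normF_sqr; apply: (@le_trans _ _ (\sum_(i < m.+1) \sum_(j < m.+1) (2 * t) ^+ 2)).
  apply: ler_sum => i _; apply: ler_sum => j _; rewrite ler_pXn2r ?nnegrE ?cabs_ge0 ?mulr_ge0//.
  by case: wellM => /(_ i j)[h1 h2] _ _; exact: cabs_le_Re_Im.
rewrite !sumr_const card_ord -mulr_natr -mulr_natr le_eqVlt; apply/orP; left.
by apply/eqP; ring.
Qed.

(** det(M) v = l adj(M) v; compare the entries of index i, where |v_i| is maximal. *)
Lemma well_conditioned_eigenvalue (v : 'cV[C]_m.+1) l :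
  M *m v = l *: v -> v <> 0 -> 1 <= cabs l * (m.+1%:R * t).
Proof.
move=> Mv v0; case: (wellM) => _ det0 hcof; have t0 := well_conditioned_ge0.
have [i _ imax] := @Order.TotalTheory.arg_maxP _ _ _ (ord0 : 'I_m.+1) xpredT
  (fun i => cabs (v i 0)) isT.
have vi : 0 < cabs (v i 0).
  apply: cabs_gt0 => vi0; apply: v0; apply/colP => j; rewrite mxE.
  apply: cabs_eq0; apply/eqP; rewrite eq_le cabs_ge0 andbT.
  by have := imax j isT; rewrite vi0 cabs0.
have E : \det M * v i 0 = l * \sum_k cofactor M k i * v k 0.
  have : \det M *: v = l *: (\adj M *m v).
    by rewrite scalemxAr -Mv mulmxA mul_adj_mx mul_scalar_mx.
  move=> /matrixP/(_ i 0); rewrite !mxE => ->; congr (_ * _).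
  by apply: eq_bigr => k _; rewrite mxE.
have D0 := cabs_gt0 det0.
have : cabs (\det M) * cabs (v i 0) <=
    cabs l * (m.+1%:R * t) * (cabs (\det M) * cabs (v i 0)).
  rewrite -[leLHS]cabsM E cabsM -!mulrA ler_wpM2l ?cabs_ge0//.
  apply: le_trans (cabs_sum _ _) _.
  apply: (@le_trans _ _ (\sum_(k < m.+1) t * cabs (\det M) * cabs (v i 0))).
    apply: ler_sum => k _; rewrite cabsM; apply: ler_pM; rewrite ?cabs_ge0//.
    exact: imax.
  by rewrite sumr_const card_ord -[leLHS]mulr_natl !mulrA.
by rewrite -[X in X <= _]mul1r ler_pM2r// mulr_gt0.
Qed.

End WellConditioned.

(** * Average cost *)

Section UpperExpectation.
Local Open Scope classical_set_scope.
Local Open Scope ereal_scope.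
Context d (T : measurableType d) (R : realType) (P : probability T R).

Lemma sum_halves (b : R) n : (0 <= b)%R -> (\sum_(i < n) b / 2 ^+ i <= 2 * b)%R.
Proof.
move=> b0; have -> : (\sum_(i < n) b / 2 ^+ i = 2 * b - 2 * b / 2 ^+ n)%R.
  elim: n => [|n IH]; first by rewrite big_ord0 expr0 divr1 subrr.
  rewrite big_ord_recr /= IH exprS; field.
  by rewrite expf_neq0.
by rewrite gerBl divr_ge0 ?mulr_ge0 ?exprn_ge0.
Qed.

(** If i is the first index with x outside S_i, then sum_k 1_(S_k)(x) >= i, so that
    c (J + sum_k 1_(S_k)) dominates f. Where no such i exists this function is
    infinite, which is why c is positive. *)
Lemma upper_expectation_levels (f : T -> \bar R) (c b : R) (J : nat) (S : nat -> set T) :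
  (0 < c)%R -> (0 <= b)%R ->
  (forall x i, ~ S i x -> f x <= (c * (J + i)%:R)%:E) ->
  (forall i, small P (S i) (b / 2 ^+ i)) ->
  upper_expectation P f <= (c * (J%:R + 2 * b))%:E.
Proof.
move=> c_gt0 b0 hf hS; have c0 := ltW c_gt0; have [B hB] := choice hS.
have mB i : measurable (B i) by case: (hB i).
pose u i x : \bar R := (\1_(B i) x)%:E.
have u0 i x : 0 <= u i x by rewrite lee_fin.
have mu i : measurable_fun setT (u i).
  by apply/measurable_EFinP; exact: measurable_indic.
pose s x := \sum_(i <oo) u i x.
have s0 x : 0 <= s x by apply: nneseries_ge0 => i _ _.
have ms : measurable_fun setT s.
  by apply: (@ge0_emeasurable_sum _ _ _ setT u xpredT).
pose g x := c%:E * (J%:R%:E + s x).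
have intg : \int[P]_t g t = c%:E * (J%:R%:E + \sum_(i <oo) P (B i)).
  rewrite ge0_integralZl_EFin//; last 2 first.
  - by move=> x _; rewrite adde_ge0// lee_fin.
  - by apply: emeasurable_funD.
  rewrite ge0_integralD//.
  rewrite integral_cst//= probability_setT mule1 integral_nneseries//.
  congr (_ * (_ + _)).
  by apply: eq_eseriesr => i _; rewrite integral_indic// setIT.
apply: (@le_trans _ _ (\int[P]_t g t)); last first.
  rewrite intg EFinM lee_wpmul2l ?lee_fin// EFinD leeD2l//.
  apply: lime_le; first by apply: is_cvg_nneseries => i _ _; exact: measure_ge0.
  apply: nearW => n; apply: (@le_trans _ _ (\sum_(0 <= i < n) (b / 2 ^+ i)%:E)).
    by apply: lee_sum => i _; case: (hB i).
  by rewrite sumEFin lee_fin big_mkord sum_halves.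
apply: ereal_inf_lbound; exists g => //; split.
  by apply: measurable_funeM; exact: emeasurable_funD.
move=> x; split; first by rewrite mule_ge0 ?adde_ge0 ?lee_fin.
have low N : (forall i, (i < N)%N -> B i x) -> (c * (J + N)%:R)%:E <= g x.
  move=> hN; rewrite /g EFinM lee_wpmul2l ?lee_fin// natrD EFinD leeD2l//.
  apply: (@le_trans _ _ (\sum_(0 <= i < N) u i x)); last by apply: nneseries_lim_ge.
  rewrite big_mkord (eq_bigr (fun=> 1)) => [|i _]; last first.
    by rewrite /u indicE mem_set//; exact: hN.
  by rewrite sumEFin sumr_const card_ord.
have [nS|allS] := pselect (exists i, `[< ~ S i x >]); last first.
  have SB i : B i x.
    case: (hB i) => _ + _; apply; apply: contra_notP allS => nSi.
    by exists i; apply/asboolP.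
  suff -> : g x = +oo by rewrite leey.
  apply/eqyP => r r0; apply: le_trans (low (Num.truncn (r / c)).+1 (fun i _ => SB i)).
  rewrite lee_fin mulrC -ler_pdivrMr//.
  by apply: le_trans (ltW (truncnS_gt _)) _; rewrite ler_nat leq_addl.
case: (ex_minnP nS) => i /asboolP nSi imin.
apply: le_trans (hf x i nSi) (low i _) => k ki.
case: (hB k) => _ + _; apply; apply: contrapT => nSk.
by have := imin k; rewrite leqNgt ki => h; have := h (asboolT nSk).
Qed.

End UpperExpectation.

Section Levels.
Variable R : realType.

(** Take for J - 3 the least integer greater than log2 log2 q. Then
    q <= 2^(2^(J-3)), and raising this to the power 4 * 2^i >= 3 + i leaves room for
    both q^3 and 2^i. *)
Lemma loglog_level (q : R) : 4 < q ->
  1 <= log2 (log2 q) /\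
  exists J, [/\ (0 < J)%N, J%:R <= log2 (log2 q) + 4 &
    forall i, q ^+ 3 * 2 ^+ i <= 2 ^+ (2 ^ (J + i - 1))].
Proof.
move=> q4; have q0 : 0 < q by lra.
have [q1 q2] : 1 <= q /\ 2 <= q by split; lra.
have l2 : 0 < ln (2 : R) by rewrite ln_gt0//; lra.
have logX k : ln ((2 : R) ^+ k) = k%:R * ln 2 by rewrite lnXn// mulr_natl.
have lq : 2 < log2 q.
  rewrite /log2 ltr_pdivlMr// -[2%R]/(2%:R) -logX ltr_ln ?posrE ?exprn_gt0//.
  by apply: le_lt_trans q4; rewrite expr2; lra.
have llq : 1 <= log2 (log2 q).
  rewrite [X in _ <= X]/log2 ler_pdivlMr// mul1r ler_ln ?posrE//; lra.
split=> //; set x := log2 (log2 q) in llq *.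
pose r := Num.truncn x; exists (r + 4)%N.
have x0 : 0 <= x by lra.
have /andP[rx xr] := truncn_itv x0.
have lq_le : log2 q <= 2 ^+ r.+1.
  rewrite -ler_ln ?posrE ?exprn_gt0//; last by lra.
  rewrite logX -ler_pdivrMr//; exact: ltW.
have q_le : q <= 2 ^+ (2 ^ r.+1).
  rewrite -ler_ln ?posrE ?exprn_gt0// logX -ler_pdivrMr//.
  by rewrite natrX.
split; first by rewrite addnS.
  by rewrite natrD lerD2r.
move=> i.
have -> : (2 ^ (r + 4 + i - 1) = 2 ^ r.+1 * (4 * 2 ^ i))%N.
  have -> : (r + 4 + i - 1 = r.+1 + (2 + i))%N by clear; lia.
  by rewrite !expnD.
rewrite exprM; apply: (@le_trans _ _ (q ^+ (4 * 2 ^ i))); last first.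
  by rewrite lerXn2r ?nnegrE ?exprn_ge0// ltW.
have ii : (3 + i <= 4 * 2 ^ i)%N.
  have := ltn_expl i (isT : (1 < 2)%N); set y := (2 ^ i)%N; clear; lia.
apply: (@le_trans _ _ (q ^+ (3 + i))).
  rewrite exprD ler_pM2l ?exprn_gt0// lerXn2r ?nnegrE//; exact: ltW.
exact: ler_weXn2l.
Qed.

End Levels.

Section WorstCost.
Variables (R : realType) (m : nat).
Local Notation C := R[i].
Local Notation n := m.+1.

Lemma newton_rateE k : newton_rate R k = 2 / 2 ^+ (2 ^ k).
Proof.
rewrite /newton_rate; have : (0 < 2 ^ k)%N by rewrite expn_gt0.
case: (2 ^ k)%N => // j _; rewrite subn1 /= exprS expr_div_n expr1n.
by rewrite invfM mulrA divff// !mul1r.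
Qed.

(** Here |A|_F <= 2 n t and 1 / |l| <= n t, so the condition
    18 |A|_F (2 / 2^(2^k)) <= eps |l| of [refine_cost] follows from the last
    hypothesis. *)
Lemma worst_cost_well_conditioned (A : 'M[C]_n) (eps t : R) k :
  0 < eps -> eps < 1 / 2 -> 0 < t -> well_conditioned t A ->
  72 * n%:R ^+ 2 * t ^+ 2 <= eps * 2 ^+ (2 ^ k) ->
  (worst_cost refine_prog eps A <= (400 * n.+1%:R ^+ 3 * k.+1%:R)%:E)%E.
Proof.
move=> e0 e1 t0 wA hk; apply: ge_ereal_sup => x [->|].
  rewrite lee_fin; apply: mulr_ge0; last exact: ler0n.
  by apply: mulr_ge0; [exact: ler0n|apply: exprn_ge0; exact: ler0n].
move=> [zeta [w [l [v [ret approx ->]]]]].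
have [Av [v0 _] _ _] := approx.
have [|c' [s' [h1 h2 _]]] := refine_cost (k := k) e0 e1 ret approx.
  have hF := well_conditioned_normF wA.
  have hl := well_conditioned_eigenvalue wA Av v0.
  have nt0 : 0 < n%:R * t by rewrite mulr_gt0// ltr0n.
  rewrite newton_rateE -(@ler_pM2r _ (n%:R * t))// -mulrA.
  apply: (@le_trans _ _ eps); last first.
    by rewrite -mulrA -[X in X <= _]mulr1 ler_pM2l.
  have Q0 : 0 < (2 : R) ^+ (2 ^ k) by rewrite exprn_gt0.
  set Q : R := 2 ^+ _ in hk Q0 *.
  have -> : 18 * (normF A * (2 / Q) * (n%:R * t)) = (36 * (n%:R * t) * normF A) / Q.
    by field; rewrite gt_eqF.
  rewrite ler_pdivrMr//; apply: le_trans hk.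
  have -> : 72 * n%:R ^+ 2 * t ^+ 2 = 36 * (n%:R * t) * (2 * n%:R * t) by ring.
  by rewrite ler_pM2l// mulr_gt0.
apply: (@le_trans _ _ (c'%:R)%:E).
  by apply: ereal_inf_lbound; exists c' => //; exists s'.
by rewrite lee_fin -natrX -!natrM ler_nat.
Qed.

Lemma refine_terminates (A : 'M[C]_n) zeta w l v (eps : R) :
  0 < eps -> eps < 1 / 2 -> returned A zeta w -> approx_eigenpair A zeta w l v ->
  l <> 0 -> exists c s, exec refine_prog (input A zeta w eps) c s.
Proof.
move=> e0 e1 ret approx l0; have cl := cabs_gt0 l0.
pose k := Num.truncn (36 * normF A / (eps * cabs l)).
have [|c [s [h _ _]]] := refine_cost (k := k) e0 e1 ret approx; last by exists c, s.
have el : 0 < eps * cabs l by rewrite mulr_gt0.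
have Q0 : 0 < (2 : R) ^+ (2 ^ k) by rewrite exprn_gt0.
rewrite newton_rateE; set Q : R := 2 ^+ _ in Q0 *.
have -> : 18 * (normF A * (2 / Q)) = 36 * normF A / Q by field; rewrite gt_eqF.
rewrite ler_pdivrMr// -ler_pdivrMl// [_^-1 * _]mulrC.
apply: le_trans (ltW (truncnS_gt _)) _; rewrite -/k /Q -natrX ler_nat.
by apply: leq_trans (ltn_expl k (isT : (1 < 2)%N)) _; apply/ltnW/ltn_expl.
Qed.

Lemma average_cost d (T : measurableType d) (P : probability T R)
    (A : T -> 'M[C]_n) (eps : R) :
  (2 <= n)%N -> 0 < eps -> eps < 1 / 2 -> gaussian_matrix P A ->
  (upper_expectation P (fun x => worst_cost refine_prog eps (A x)) <=
   (400 * 8 * 204 * n%:R ^+ 3 * log2 (log2 (n%:R / eps)))%:E)%E.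
Proof.
move=> n2 e0 e1 gA; set q := n%:R / eps.
have n2R : (2 : R) <= n%:R by rewrite ler_nat.
have n0 : (0 : R) < n%:R by rewrite ltr0n.
have qe : q * eps = n%:R by rewrite divfK// gt_eqF.
have q4 : 4 < q by rewrite ltr_pdivlMr//; lra.
have q0 : 0 < q by lra.
have [x1 [J [J0 Jx Jq]]] := loglog_level q4.
(* the scale at which J + i Newton steps suffice: 72 n^2 t^2 <= eps 2^(2^(J+i)) *)
pose t i : R := eps * 2 ^+ (2 ^ (J + i - 1)) / (9 * n%:R).
have t0 i : 0 < t i by rewrite divr_gt0 ?mulr_gt0 ?exprn_gt0.
apply: le_trans (upper_expectation_levels (P := P) (c := 400 * n.+1%:R ^+ 3) (b := 99)
  (J := J.+1) (S := fun i => [set x | ~ well_conditioned (t i) (A x)]%classic) _ _ _ _) _.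
- by rewrite mulr_gt0 ?exprn_gt0 ?ltr0n.
- by rewrite ler0n.
- move=> x i /contrapT wA; rewrite addSn.
  apply: (worst_cost_well_conditioned e0 e1 (t0 i) wA).
  have -> : (2 : R) ^+ (2 ^ (J + i)) = 2 ^+ (2 ^ (J + i - 1)) ^+ 2.
    rewrite -exprM; congr (_ ^+ _); rewrite -{1}(subnK (leq_trans J0 (leq_addr i J))).
    by rewrite addn1 expnSr.
  rewrite /t; set Q : R := 2 ^+ _.
  have -> : 72 * n%:R ^+ 2 * (eps * Q / (9 * n%:R)) ^+ 2 = (72 / 81) * eps * (eps * Q ^+ 2).
    by field; rewrite gt_eqF.
  have Q2 : 0 <= eps * Q ^+ 2 by rewrite mulr_ge0 ?sqr_ge0// ltW.
  rewrite -[leRHS]mul1r ler_wpM2r//; lra.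
- move=> i; apply: smallS (gaussian_well_conditioned gA (t0 i)) => //.
  have Qi := Jq i; rewrite /t; set Q : R := 2 ^+ (2 ^ (J + i - 1)) in Qi *.
  have Q0 : 0 < Q by rewrite exprn_gt0.
  have i0 : 0 < (2 : R) ^+ i by rewrite exprn_gt0.
  set z : R := 2 ^+ i in Qi i0 *.
  have -> : 11 * n%:R ^+ 2 / (eps * Q / (9 * n%:R)) = 99 * n%:R ^+ 3 / eps / Q.
    by field; rewrite !gt_eqF.
  have h : n%:R ^+ 3 / eps <= q ^+ 3.
    rewrite ler_pdivrMr// -qe exprMn ler_pM2l ?exprn_gt0//.
    by rewrite exprS ger_pMr// expr_le1// ltW//; lra.
  rewrite ler_pdivrMr// [leRHS]mulrAC ler_pdivlMr//.
  have -> : 99 * n%:R ^+ 3 / eps * z = 99 * (n%:R ^+ 3 / eps * z) by ring.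
  by rewrite ler_pM2l//; apply: le_trans Qi; rewrite ler_pM2r.
rewrite lee_fin; set x := log2 (log2 q) in x1 Jx *.
have J1 : J.+1%:R + 2 * 99 <= 204 * x by rewrite -natr1; lra.
have n1 : n.+1%:R ^+ 3 <= 8 * n%:R ^+ 3 :> R.
  have -> : 8 * n%:R ^+ 3 = (2 * n%:R) ^+ 3 :> R by ring.
  rewrite lerXn2r ?nnegrE ?mulr_ge0 ?ler0n//; rewrite -natr1; lra.
apply: (@le_trans _ _ (400 * (8 * n%:R ^+ 3) * (204 * x))).
  apply: ler_pM; last exact: J1.
  - by apply: mulr_ge0; [exact: ler0n|apply: exprn_ge0; exact: ler0n].
  - by apply: addr_ge0; [exact: ler0n|apply: mulr_ge0; exact: ler0n].
  - by apply: ler_wpM2l n1; exact: ler0n.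
by rewrite le_eqVlt; apply/orP; left; apply/eqP; ring.
Qed.

End WorstCost.

Theorem theorem1p1 (R : realType) :
  exists (p : prog) (K : R), forall (m : nat), (2 <= m.+1)%N ->
  forall eps : R, 0 < eps -> eps < 1 / 2 ->
  (forall (A : 'M[R[i]]_m.+1) (zeta : R[i]) (w : 'cV[R[i]]_m.+1)
          (l : R[i]) (v : 'cV[R[i]]_m.+1),
     returned A zeta w -> approx_eigenpair A zeta w l v ->
     (l <> 0 -> exists c s, exec p (input A zeta w eps) c s) /\
     (forall c s, exec p (input A zeta w eps) c s ->
        [/\ out_vec m s <> 0, dP (out_vec m s) v <= eps
          & cabs (out_zeta s - l) <= eps * cabs l])) /\
  (forall (d : measure_display) (T : measurableType d) (P : probability T R)
          (A : T -> 'M[R[i]]_m.+1),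
     gaussian_matrix P A ->
     (upper_expectation P (fun t => worst_cost p eps (A t)) <=
      (K * m.+1%:R ^+ 3 * log2 (log2 (m.+1%:R / eps)))%:E)%E).
Proof.
exists refine_prog, (400 * 8 * 204) => m n2 eps e0 e1; split.
  move=> A zeta w l v ret approx; split.
    exact: (refine_terminates e0 e1 ret approx).
  by move=> c s; exact: (refine_correct e0 e1 ret approx).
by move=> d T P A gA; exact: (average_cost n2 e0 e1 gA).
Qed.
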